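(* Let $E$ be a pseudo effect algebra whose state space $\mathcal S(E)$ is a nonempty Bauer simplex, let $m$ be a Jordan signed measure on $E$ and let $m=\alpha_1s_1-\alpha_2s_2$ be its canonical Jordan decomposition. Then there are unique regular Borel probability measures $\mu_{s_1},\mu_{s_2}$ on $\mathcal B(\mathcal S(E))$ with $\mu_{s_i}(\partial_e\mathcal S(E))=1$ ($i=1,2$) such that, with $\mu_m:=\alpha_1\mu_{s_1}-\alpha_2\mu_{s_2}$, $$m(a)=\alpha_1\int_{\partial_e\mathcal S(E)}\hat a(x)\,d\mu_{s_1}(x)-\alpha_2\int_{\partial_e\mathcal S(E)}\hat a(x)\,d\mu_{s_2}(x)=\int_{\partial_e\mathcal S(E)}\hat a(x)\,d\mu_m(x)$$ for every $a\in E$, where $\hat a(x)=x(a)$.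
   Context: Pseudo effect algebra: partial algebra $(E;+,0,1)$ such that for all $a,b,c$: (i) $a+b$ and $(a+b)+c$ exist iff $b+c$ and $a+(b+c)$ exist, and then they are equal; (ii) there is exactly one $d$ and one $e$ with $a+d=e+a=1$; (iii) if $a+b$ exists there are $d,e$ with $a+b=d+a=b+e$; (iv) if $1+a$ or $a+1$ exists then $a=0$. Signed measure: $m:E\to\mathbb R$ additive on defined sums; measure: nonnegative one; state: measure with $s(1)=1$; $\mathcal S(E)$: set of states with the pointwise-convergence topology; $\partial_e\mathcal S(E)$: its extreme points. Bauer simplex: a compact simplex (convex set affinely isomorphic to a base of a lattice cone) in a locally convex Hausdorff space whose set of extreme points is compact. Jordan signed measure: difference of two measures; the set $\mathcal J(E)$ of these, ordered by $m_1\le^+m_2$ iff $m_2-m_1$ is a measure, is a lattice-ordered group (the paper uses this for $E$ with the Riesz Decomposition Property); $m^+=m\vee0$, $m^-=-(m\wedge0)$. Canonical Jordan decomposition: $m=\alpha_1s_1-\alpha_2s_2$ with $\alpha_i\ge0$, $s_i$ states, $\alpha_1s_1=m^+$, $\alpha_2s_2=m^-$.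
   Formalization: Uniqueness is proved for each measure as the one representing the state s_i, not for pairs satisfying only the formula for m (false if some α_i=0, e.g. m=0; if α_i>0 it follows by minimality of m^+, m^-); the integral against μ_m is defined as α1∫dμ_{s1} − α2∫dμ_{s2}. *)

(* Defs.v *)
From HB Require Import structures.
From mathcomp Require Import all_boot all_order all_algebra.
From mathcomp Require Import all_classical all_reals all_analysis.
Set Implicit Arguments. Unset Strict Implicit. Unset Printing Implicit Defensive.
Import Order.TTheory GRing.Theory Num.Theory.
Import numFieldTopology.Exports numFieldNormedType.Exports.
Local Open Scope classical_set_scope.
Local Open Scope ring_scope.

Definition padd {E : Type} (plus : E -> E -> option E) (x y : option E) : option E :=
  match x, y with Some a, Some b => plus a b | _, _ => None end.

Record peaType := PEA {
  pea_car :> Type;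
  pea_plus : pea_car -> pea_car -> option pea_car;
  pea_zero : pea_car;
  pea_one : pea_car;
  pea_assoc : forall a b c : pea_car,
    padd pea_plus (pea_plus a b) (Some c) = padd pea_plus (Some a) (pea_plus b c);
  pea_compl : forall a : pea_car,
    (exists d, pea_plus a d = Some pea_one /\ forall d', pea_plus a d' = Some pea_one -> d' = d) /\
    (exists e, pea_plus e a = Some pea_one /\ forall e', pea_plus e' a = Some pea_one -> e' = e);
  pea_conj : forall a b c : pea_car, pea_plus a b = Some c ->
    exists d e, pea_plus d a = Some c /\ pea_plus b e = Some c;
  pea_one_plus : forall a : pea_car,
    (pea_plus pea_one a <> None \/ pea_plus a pea_one <> None) -> a = pea_zero
}.

Section Measures.
Variables (R : realType) (E : peaType).

Definition signed_measure (m : E -> R) : Prop :=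
  forall a b c : E, pea_plus a b = Some c -> m c = m a + m b.
Definition is_measure (m : E -> R) : Prop :=
  signed_measure m /\ forall a : E, 0 <= m a.
Definition is_state (s : E -> R) : Prop :=
  is_measure s /\ s (pea_one E) = 1.
Definition jordan_signed_measure (m : E -> R) : Prop :=
  exists m1 m2 : E -> R, is_measure m1 /\ is_measure m2 /\ m = (fun a => m1 a - m2 a).
Definition jle (m1 m2 : E -> R) : Prop := is_measure (fun a => m2 a - m1 a).
Definition jsup (m1 m2 p : E -> R) : Prop :=
  [/\ jordan_signed_measure p, jle m1 p, jle m2 p &
      forall q, jordan_signed_measure q -> jle m1 q -> jle m2 q -> jle p q].
Definition jinf (m1 m2 p : E -> R) : Prop :=
  [/\ jordan_signed_measure p, jle p m1, jle p m2 &
      forall q, jordan_signed_measure q -> jle q m1 -> jle q m2 -> jle q p].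
Definition zero_meas : E -> R := fun _ => 0.
Definition canonical_jordan_decomposition (m : E -> R) (a1 : R) (s1 : E -> R)
    (a2 : R) (s2 : E -> R) : Prop :=
  [/\ 0 <= a1 /\ 0 <= a2, is_state s1 /\ is_state s2,
      m = (fun a => a1 * s1 a - a2 * s2 a),
      jsup m zero_meas (fun a => a1 * s1 a) &
      jinf m zero_meas (fun a => - (a2 * s2 a))].

Local Notation RE := {ptws pea_car E -> Real.sort R}.
Definition state_space : set RE := [set s | is_state s].

Definition extreme_point (K : set RE) (s : RE) : Prop :=
  K s /\ forall (s1 s2 : RE) (l : R), K s1 -> K s2 -> 0 < l < 1 ->
    s = (fun a => l * s1 a + (1 - l) * s2 a) -> s1 = s /\ s2 = s.
Definition ext_states : set RE := extreme_point state_space.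

(** positive cone generated by [K] (a base of it when [K] lies in an affine
    hyperplane missing 0, as the state space does: s(1) = 1) *)
Definition gen_cone (K : set RE) : set RE :=
  [set f | exists t s, 0 <= t /\ K s /\ f = (fun a => t * s a)].
Definition cone_le (C : set RE) (f g : RE) : Prop :=
  C (fun a => g a - f a).
Definition lattice_cone (C : set RE) : Prop :=
  forall f g, C f -> C g ->
    (exists u, [/\ C u, cone_le C f u, cone_le C g u &
        forall v, C v -> cone_le C f v -> cone_le C g v -> cone_le C u v]) /\
    (exists w, [/\ C w, cone_le C w f, cone_le C w g &
        forall v, C v -> cone_le C v f -> cone_le C v g -> cone_le C v w]).
Definition convex (K : set RE) : Prop :=
  forall (s1 s2 : RE) (l : R), K s1 -> K s2 -> 0 <= l <= 1 ->
    K (fun a => l * s1 a + (1 - l) * s2 a).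
Definition simplex (K : set RE) : Prop :=
  convex K /\ lattice_cone (gen_cone K).
End Measures.

Section Bauer.
Variables (R : realType) (E : peaType).
Local Notation RE := {ptws pea_car E -> Real.sort R}.

Definition bauer_simplex (K : set (RE)) : Prop :=
  [/\ compact K, simplex K & compact (extreme_point K)].

(** The state space as a topological space (subspace topology of R^E),
    pointed using a witness of non-emptiness. *)
Definition state_space_type (h : (@state_space R E) !=set0) : Type :=
  set_type ((@state_space R E)).
Definition state_pt (h : (@state_space R E) !=set0) : set_type ((@state_space R E)) :=
  exist _ (sval (cid h)) (mem_set (svalP (cid h))).
HB.instance Definition _ (h : (@state_space R E) !=set0) :=
  Topological.copy (state_space_type h) (set_type ((@state_space R E))).
HB.instance Definition _ (h : (@state_space R E) !=set0) :=
  isPointed.Build (state_space_type h) (state_pt h).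

Definition borel_states (h : (@state_space R E) !=set0) :=
  g_sigma_algebraType (@open (state_space_type h)).

Definition ext_boundary (h : (@state_space R E) !=set0) : set (borel_states h) :=
  [set x | extreme_point ((@state_space R E)) (sval x)].

Definition regular_measure (h : (@state_space R E) !=set0)
    (mu : set (borel_states h) -> \bar R) : Prop :=
  forall A : set (borel_states h), measurable A ->
    mu A = ereal_sup [set mu K | K in [set K : set (state_space_type h) |
                                          compact K /\ K `<=` A]] /\
    mu A = ereal_inf [set mu U | U in [set U : set (state_space_type h) |
                                          open U /\ A `<=` U]].

Definition ahat (h : (@state_space R E) !=set0) (a : E) : borel_states h -> R :=
  fun x => sval x a.

Definition boundary_representing (h : (@state_space R E) !=set0)
    (s : E -> R) (mu : probability (borel_states h) R) : Prop :=
  [/\ regular_measure mu, mu (@ext_boundary h) = 1%E &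
      forall a : E, s a = Rintegral mu (@ext_boundary h) (@ahat h a)].

(** integral against the signed measure mu_m = a1 mu1 - a2 mu2 *)
Definition signed_Rintegral (h : (@state_space R E) !=set0)
    (a1 : R) (mu1 : probability (borel_states h) R)
    (a2 : R) (mu2 : probability (borel_states h) R)
    (D : set (borel_states h)) (f : borel_states h -> R) : R :=
  a1 * Rintegral mu1 D f - a2 * Rintegral mu2 D f.
End Bauer.

(* Main.v *)
(* A state [s] of a Bauer simplex has a representing measure on the compact set
   [X] of extreme states: by Krein-Milman, [s] lies in the compact convex set of
   barycenters of finitely additive probabilities carried by [X], and such a
   probability is dominated on closed sets by a regular Borel measure, obtained
   by Caratheodory's construction.  Applying the resulting inequality to an
   element and to its complement gives the integral formula.

   For uniqueness, the closed cone [C F] generated by a closed [F] in [X] is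
   hereditary for the measure order, by the Riesz decomposition property, and it
   contains no extreme state outside [F], by Milman's theorem.  Hence measures in
   [C F] and [C G] are orthogonal when [F] and [G] are disjoint.  If [P] and [Q]
   both represent [s], the restricted barycenters [p] of [P] on [F] and [q] of [Q]
   on [G] are both below [s], so [p + q <= s] and [P F + Q G <= 1]; regularity
   then gives [P <= Q]. *)
Require Import Defs.
From HB Require Import structures.
From mathcomp Require Import all_boot all_order all_algebra.
From mathcomp Require Import finmap.
From mathcomp Require Import all_classical all_reals all_analysis.
From mathcomp Require Import ring lra.
Set Implicit Arguments. Unset Strict Implicit. Unset Printing Implicit Defensive.
Import Order.TTheory GRing.Theory Num.Theory.
Import numFieldTopology.Exports numFieldNormedType.Exports.
Local Open Scope classical_set_scope.
Local Open Scope ring_scope.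

(** * Compact convex sets of functions *)

Section ContinuousReal.
Variables (R : realType) (T : topologicalType).
Implicit Types f g : T -> R.

Lemma continuous_add f g : continuous f -> continuous g ->
  continuous (fun z => f z + g z).
Proof. by move=> cf cg z; apply: cvgD; [exact: cf|exact: cg]. Qed.

Lemma continuous_mul f g : continuous f -> continuous g ->
  continuous (fun z => f z * g z).
Proof. by move=> cf cg z; apply: cvgM; [exact: cf|exact: cg]. Qed.

Lemma continuous_opp f : continuous f -> continuous (fun z => - f z).
Proof. by move=> cf z; apply: cvgN; exact: cf. Qed.

End ContinuousReal.

(* The library's [compact_cover] is stated for pointed spaces only. *)
Lemma compact_finite_subcover (T : topologicalType) (A : set T) :
  compact A -> cover_compact A.
Proof.
move=> cA; have [[x Ax]|A0] := pselect (A !=set0); last first.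
  move=> J D f _ _; exists fset0 => [j|x Ax]; first by rewrite inE.
  by case: A0; exists x.
pose pT : ptopologicalType := HB.pack_for ptopologicalType T (isPointed.Build T x).
by have : @cover_compact pT A by rewrite -compact_cover.
Qed.

Section FunctionSpace.
Variables (R : realType) (I : Type).
Local Notation RI := {ptws I -> Real.sort R}.
Implicit Types (K D F A : set RI) (x y z v w : RI) (l : seq (R * I)).

Lemma coord_continuous (i : I) : continuous (fun f : RI => f i).
Proof. exact: (@proj_continuous {classic I} (fun=> R : topologicalType) i). Qed.

Lemma ptws_hausdorff : hausdorff_space RI.
Proof.
apply: (@hausdorff_product {classic I} (fun=> R : topologicalType)) => _.
exact: Rhausdorff.
Qed.

(** Every continuous linear functional on [RI] with the product topology has this form, so these are
    the functionals available for separation. *)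
Definition lin l (z : I -> R) : R := \sum_(ca <- l) ca.1 * z ca.2.

Lemma lin_nil z : lin [::] z = 0.
Proof. exact: big_nil. Qed.

Lemma lin_cons c i l z : lin ((c, i) :: l) z = c * z i + lin l z.
Proof. exact: big_cons. Qed.

Lemma lin_continuous l : continuous (lin l : RI -> R).
Proof.
elim: l => [|[c i] l IH].
  by rewrite (_ : lin [::] = cst 0) ?funeqE // => [? |z];
    [exact: cst_continuous|exact: lin_nil].
rewrite (_ : lin _ = fun z => c * z i + lin l z); last first.
  by apply/funext => z; exact: lin_cons.
apply: continuous_add IH; apply: continuous_mul; last exact: coord_continuous.
exact: cst_continuous.
Qed.

Lemma lin_comb l x y (s t : R) :
  lin l (fun i => s * x i + t * y i) = s * lin l x + t * lin l y.
Proof.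
elim: l => [|[c i] l IH]; first by rewrite !lin_nil; ring.
by rewrite !lin_cons IH; ring.
Qed.

Lemma lin_opp l z : lin [seq (- ci.1, ci.2) | ci <- l] z = - lin l z.
Proof. by rewrite /lin big_map -sumrN; apply: eq_bigr => ci _; rewrite mulNr. Qed.

Lemma closed_lin_ge l (b : R) : closed [set z : RI | b <= lin l z].
Proof.
have /continuous_closedP cl := @lin_continuous l.
exact: cl (@closed_ge R b).
Qed.

Lemma closed_lin_eq l (b : R) : closed [set z : RI | lin l z = b].
Proof.
have /continuous_closedP cl := @lin_continuous l.
exact: cl (@closed_eq R b).
Qed.

Lemma compact_min K (f : RI -> R) : compact K -> K !=set0 -> continuous f ->
  exists2 c, K c & forall z, K z -> f c <= f z.
Proof.
move=> cK K0 cf; have [|c] := @compact_EVT_min _ _ f K K0 cK.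
  exact: continuous_subspaceT.
rewrite inE => Kc fc; exists c => // z Kz; apply: fc; exact: mem_set.
Qed.

Definition fconvex K := forall (x y : I -> R) (t : R), K x -> K y ->
  0 <= t <= 1 -> K (fun i => t * x i + (1 - t) * y i).

Definition fextreme K z := K z /\ forall (x y : RI) (t : R), K x -> K y ->
  0 < t < 1 -> z = (fun i => t * x i + (1 - t) * y i) -> x = z /\ y = z.

(** The open conditions [z i != y i] cover [D], and a finite subcover names the coordinates. This
    reduces separation to Euclidean geometry in finitely many dimensions. *)
Lemma finite_coord_separation D y : compact D -> ~ D y ->
  exists s : seq I, forall z, D z -> exists2 i, List.In i s & z i != y i.
Proof.
move=> cD Dy.
pose U (i : {classic I}) : set RI := [set z | z i != y i].
have oU i : [set: {classic I}] i -> open (U i).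
  move=> _; rewrite (_ : U i = (fun z : RI => z i) @^-1` (~` [set y i])).
    apply: open_comp; first by move=> z _; exact: coord_continuous.
    apply: closed_openC; exact: (@closed_eq R (y i)).
  by apply/seteqP; split => z /= /eqP.
have cov : D `<=` cover setT U.
  move=> z Dz; apply: contrapT => nz; apply: Dy; suff -> : y = z by [].
  apply/funext => i; apply: contrapT => /eqP yz; apply: nz; exists i => //.
  by rewrite /U/= eq_sym.
have [s _ sP] := compact_finite_subcover cD oU cov.
exists (enum_fset s) => z /sP [i /= si zi]; exists i => //.
have : i \in enum_fset s by exact: si.
elim: (enum_fset s) => // a r IH.
by rewrite in_cons => /orP[/eqP ->|/IH]; [left|right].
Qed.

(** Hahn-Banach by projection: [c] is a point of [D] nearest to [y] in the finitely many coordinates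
    [s], and the functional is the inner product with [y - c]. *)
Lemma separation D y : compact D -> fconvex D -> ~ D y ->
  exists l b, (forall z, D z -> lin l z <= b) /\ b < lin l y.
Proof.
move=> cD vD Dy.
have [D0|/set0P/negP/negPn/eqP D0] := pselect (D !=set0); last first.
  exists [::], (-1); split; first by move=> z; rewrite D0.
  by rewrite lin_nil ltrN10.
have [s sP] := finite_coord_separation cD Dy.
pose q (z : RI) : R := \sum_(i <- s) (z i - y i) ^+ 2.
have cq : continuous q.
  rewrite /q; elim: (s) => [|i r IH].
    rewrite (_ : (fun _ => _) = cst 0); first exact: cst_continuous.
    by apply/funext => z; rewrite big_nil.
  rewrite (_ : (fun _ => _) =
     fun z : RI => (z i - y i) * (z i - y i) + \sum_(j <- r) (z j - y j) ^+ 2).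
    apply: continuous_add IH; apply: continuous_mul.
      by apply: continuous_add; [exact: coord_continuous|exact: cst_continuous].
    by apply: continuous_add; [exact: coord_continuous|exact: cst_continuous].
  by apply/funext => z; rewrite big_cons expr2.
have [c Dc cmin] := compact_min cD D0 cq.
pose l := [seq (y i - c i, i) | i <- s].
have linE z : lin l z = \sum_(i <- s) (y i - c i) * z i.
  by rewrite /lin big_map.
have qc : 0 < q c.
  have q0 : 0 <= q c by apply: sumr_ge0 => i _; exact: sqr_ge0.
  rewrite lt_neqAle q0 andbT eq_sym; apply/negP => /eqP qc0.
  have [i si ci] := sP _ Dc.
  move: qc0 si; rewrite /q; elim: (s) => //= j r IH; rewrite big_cons => /eqP.
  rewrite paddr_eq0 ?sqr_ge0 ?sumr_ge0 // => [/andP[/eqP h1 /eqP h2]|k _].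
    case=> [ji|]; last exact: IH.
    by move: h1 ci => /eqP; rewrite sqrf_eq0 subr_eq0 ji => ->.
  exact: sqr_ge0.
exists l, (lin l c); split; last first.
  rewrite -subr_gt0 !linE -sumrB (eq_bigr (fun i => (c i - y i) ^+ 2)) //.
  by move=> i _; ring.
move=> z Dz; rewrite -subr_le0 leNgt; apply/negP.
set d := _ - _ => d0.
(* Here [d] is the inner product of [y - c] and [z - c], and [e] is the squared length of [z - c];
   [qt] expands the squared distance to [y] along the segment from [c] to [z]. *)
pose e := q z - q c + d *+ 2.
have qt t : q (fun i => t * z i + (1 - t) * c i) = q c - t * d *+ 2 + t ^+ 2 * e.
  suff h : d = \sum_(i <- s) (y i - c i) * (z i - c i) /\
         e = \sum_(i <- s) (z i - c i) ^+ 2.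
    have [-> ->] := h; rewrite /q !mulr_sumr -sumrMnl -sumrB -big_split.
    by apply: eq_bigr => i _ /=; ring.
  have dE : d = \sum_(i <- s) (y i - c i) * (z i - c i).
    by rewrite /d !linE -sumrB; apply: eq_bigr => i _; ring.
  split => //; rewrite /e dE /q -sumrB -sumrMnl -big_split.
  by apply: eq_bigr => i _ /=; ring.
have key t : 0 <= t <= 1 -> 0 <= t ^+ 2 * e - t * d *+ 2.
  move=> t01; have := cmin _ (vD _ _ _ Dz Dc t01); rewrite qt; lra.
have e1 := key 1; rewrite lexx ler01 expr1n in e1.
have e0 : 0 < e by move: (e1 isT); lra.
(* This [t] minimizes [t ^+ 2 * e - t * d *+ 2], with negative value [- (d ^+ 2 / e)]. It is at most
   1 because [key 1] gives [d *+ 2 <= e]. *)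
pose t := d / e.
have t01 : 0 <= t <= 1.
  by rewrite divr_ge0 ?(ltW d0) ?(ltW e0) //= ler_pdivrMr //; move: (e1 isT); lra.
have := key t t01; rewrite /t.
rewrite (_ : _ - _ = - (d ^+ 2 / e)); last by field; rewrite gt_eqF.
by rewrite oppr_ge0 leNgt divr_gt0 // exprn_gt0.
Qed.

(** * Closed faces and the Krein-Milman theorem *)

Record closed_face K (F : set RI) : Prop := ClosedFace {
  face_closed : closed F;
  face_sub : F `<=` K;
  face_nonempty : F !=set0;
  face_extreme : forall (x y : RI) (t : R), K x -> K y -> 0 < t < 1 ->
    F (fun i => t * x i + (1 - t) * y i) -> F x /\ F y }.

(** If a proper convex combination of two points of [F] attains the minimum of [lin l] on [F], then
    so do both points. *)
Lemma closed_face_min K F l : compact K -> closed_face K F ->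
  exists2 c, F c & (forall z, F z -> lin l c <= lin l z) /\
    closed_face K (F `&` [set z | lin l z = lin l c]).
Proof.
move=> cK [cF FK F0 eF].
have kF : compact F by exact: subclosed_compact cK FK.
have [c Fc cmin] := compact_min kF F0 (@lin_continuous l).
exists c => //; split => //; split.
- by apply: closedI => //; exact: closed_lin_eq.
- by move=> z [/FK].
- by exists c.
move=> x y t Kx Ky t01 [Fxy]; have [Fx Fy] := eF _ _ _ Kx Ky t01 Fxy.
rewrite /= lin_comb => e; have := cmin _ Fx; have := cmin _ Fy.
by split; split => //=; nra.
Qed.

(* Zorn's lemma yields a minimal closed face; minimizing each coordinate shows
   that it is a single point. *)
Lemma closed_face_extreme K F : compact K -> closed_face K F ->
  exists2 e, F e & fextreme K e.
Proof.
move=> cK fF.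
(* Zorn's lemma for unions of chains gives a maximal removed part [A], that is, a minimal face [F]
   minus [A]. *)
pose P (A : set RI) := closed_face K (F `\` A).
have [|A [PA Amax]] := @Zorn_bigcup _ P.
  move=> C CP Ctot.
  have [C0|/set0P/negP/negPn/eqP ->] := pselect (C !=set0); last first.
    by rewrite bigcup_set0 /P setD0.
  have closedC A : C A -> closed (F `\` A) by move=> /CP [].
  have kF : compact F.
    exact: subclosed_compact (face_closed fF) cK (face_sub fF).
  have FE : F `\` \bigcup_(A in C) A = F `&` \bigcap_(A in C) (F `\` A).
    apply/seteqP; split => [z [Fz nz]|z [Fz nz]].
      by split => // A CA; split => // Az; apply: nz; exists A.
    by split => // -[A CA Az]; have [] := nz _ CA.
  split.
  - rewrite FE; apply: closedI; first exact: face_closed fF.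
    exact: closed_bigI.
  - by move=> z [/(face_sub fF)].
  (* If the faces of the chain had empty intersection, finitely many of their complements would
     cover [F]. The largest removed part [B] among these contains the others, and a point of [F]
     outside [B] is then not covered. *)
  - apply: contrapT => emp.
    have cov : F `<=` cover C (fun A => ~` (F `\` A)).
      move=> z Fz; apply: contrapT => nz; apply: emp; exists z; rewrite FE.
      by split => // A CA; apply: contrapT => nA; apply: nz; exists A.
    have [A /closedC ?|s sC scov] := compact_finite_subcover kF _ cov.
      exact: closed_openC.
    have [B CB sB] : exists2 B, C B & forall A, A \in enum_fset s -> A `<=` B.
      have : forall A, A \in enum_fset s -> C A by move=> A /sC; rewrite inE.
      elim: (enum_fset s) => [_|A r IH rC]; first by have [B CB] := C0; exists B.
      have [B CB rB] := IH (fun B rB => rC B (@mem_behead _ (A :: r) B rB)).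
      have CA := rC A (mem_head _ _).
      have [AB|BA] := Ctot _ _ CA CB.
        by exists B => // D; rewrite in_cons => /orP[/eqP ->|/rB].
      exists A => // D; rewrite in_cons => /orP[/eqP ->//|/rB DB].
      exact: subset_trans BA.
    have [z [Fz nBz]] := face_nonempty (CP _ CB).
    have [A sA] := scov _ Fz; apply; split => // Az; apply: nBz.
    exact: sB Az.
  - move=> x y t Kx Ky t01 [Fxy nxy]; have [Fx Fy] := face_extreme fF Kx Ky t01 Fxy.
    split; split => // -[A CA Az]; have : (F `\` A) (fun i => t * x i + (1 - t) * y i).
    + by split => // Axy; apply: nxy; exists A.
    + by move=> /(face_extreme (CP _ CA) Kx Ky t01) [[]].
    + by split => // Axy; apply: nxy; exists A.
    + by move=> /(face_extreme (CP _ CA) Kx Ky t01) [_ []].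
have uniq (z1 z2 : RI) : (F `\` A) z1 -> (F `\` A) z2 -> forall i, z1 i <= z2 i.
  move=> Az1 Az2 i; rewrite leNgt; apply/negP => z12.
  have [c Ac [cmin fc]] := closed_face_min [:: (1, i)] cK PA.
  set G := _ `&` _ in fc.
  apply: (Amax (~` G)).
    split=> [z Az [[_ /(_ Az)]]//|/(_ z1) nz1]; case: Az1 => _; apply; apply: nz1.
    move=> [_ /=]; have := cmin _ Az2; rewrite !lin_cons !lin_nil; lra.
  rewrite /P (_ : F `\` ~` G = G) //; apply/seteqP; split => [z [_ /contrapT]//|z Gz].
  by split; [case: Gz => [[]]|move=> /(_ Gz)].
have [e Ae] := face_nonempty PA.
have eq_e z : (F `\` A) z -> z = e.
  by move=> Az; apply/funext => i; apply/eqP; rewrite eq_le !uniq.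
exists e; first by case: Ae.
split; first exact: face_sub Ae.
move=> x y t Kx Ky t01 exy; have [Ax Ay] : (F `\` A) x /\ (F `\` A) y.
  by apply: (face_extreme PA Kx Ky t01); rewrite -exy.
by split; exact: eq_e.
Qed.

(** The form of Krein-Milman used throughout: an inequality for a linear functional on [K] need only
    be checked at extreme points. *)
Lemma extreme_min K l : compact K -> K !=set0 ->
  exists2 e, fextreme K e & forall z, K z -> lin l e <= lin l z.
Proof.
move=> cK K0; have fK : closed_face K K.
  by split => //; exact: (compact_closed ptws_hausdorff).
have [c Kc [cmin fc]] := closed_face_min l cK fK.
have [e [Ke ec] exte] := closed_face_extreme cK fc.
by exists e => // z Kz; rewrite ec; exact: cmin.
Qed.

Lemma continuous_ptws (T : topologicalType) (f : T -> RI) :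
  (forall i, continuous (fun t => f t i)) -> continuous f.
Proof.
move=> cf t; apply/cvg_sup => i A [_ [[B oB <-] Bt] BA].
apply: (filterS BA); apply: (cf i t); exact: open_nbhs_nbhs.
Qed.

Lemma fconvex_comb A x y (p q : R) : fconvex A -> A x -> A y ->
  0 <= p -> 0 <= q ->
  exists2 z, A z & forall i, p * x i + q * y i = (p + q) * z i.
Proof.
move=> vA Ax Ay p0 q0; have [pq|pq] := eqVneq (p + q) 0.
  have [p00 q00] : p = 0 /\ q = 0 by split; lra.
  by exists x => // i; rewrite p00 q00; ring.
have pq0 : 0 < p + q by rewrite lt_neqAle eq_sym pq addr_ge0.
exists (fun i => p / (p + q) * x i + (1 - p / (p + q)) * y i) => [|i].
  apply: vA => //; rewrite divr_ge0 ?(ltW pq0) //=.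
  by rewrite ler_pdivrMr // mul1r; lra.
by field.
Qed.

(* The closed convex cone generated by [F]; this description makes membership of
   barycenters immediate. *)
Definition bipolar (F : set RI) : set RI :=
  [set v | forall l, (forall x, F x -> 0 <= lin l x) -> 0 <= lin l v].

Lemma sub_bipolar F : F `<=` bipolar F.
Proof. by move=> x Fx l; apply. Qed.

Lemma bipolarS F1 F2 : F1 `<=` F2 -> bipolar F1 `<=` bipolar F2.
Proof. by move=> F12 v Fv l lF; apply: Fv => x /F12 /lF. Qed.

Lemma bipolar_closed F : closed (bipolar F).
Proof.
rewrite (_ : bipolar F = \bigcap_(l in [set l | forall x, F x -> 0 <= lin l x])
   [set v | 0 <= lin l v]); last by [].
apply: closed_bigI => l _; exact: closed_lin_ge.
Qed.

Lemma bipolar_comb F v w (s t : R) : bipolar F v -> bipolar F w ->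
  0 <= s -> 0 <= t -> bipolar F (fun i => s * v i + t * w i).
Proof.
move=> Fv Fw s0 t0 l lF; rewrite lin_comb addr_ge0 // mulr_ge0 //.
  exact: Fv.
exact: Fw.
Qed.

Lemma bipolar_convex F : fconvex (bipolar F).
Proof.
by move=> x y t Fx Fy /andP[t0 t1]; apply: bipolar_comb; rewrite ?subr_ge0.
Qed.

Lemma fconvexI A D : fconvex A -> fconvex D -> fconvex (A `&` D).
Proof.
by move=> vA vD x y t [Ax Dx] [Ay Dy] t01; split; [exact: vA|exact: vD].
Qed.

Lemma fextreme_sub A D x : A `<=` D -> A x -> fextreme D x -> fextreme A x.
Proof.
by move=> AD Ax [_ ex]; split => // y z t /AD Dy /AD Dz; exact: ex.
Qed.

(** For nonempty convex [A] and [D], this is the convex hull of their union. *)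
Definition join (A D : set RI) : set RI :=
  [set z | exists t x y, [/\ 0 <= t <= 1, A x, D y &
     z = (fun i => t * x i + (1 - t) * y i)]].

Lemma join_convex A D : fconvex A -> fconvex D -> fconvex (join A D).
Proof.
move=> vA vD z1 z2 s [t [x [y [/andP[t0 t1] Ax Dy ->]]]].
move=> [t' [x' [y' [/andP[t0' t1'] Ax' Dy' ->]]]] /andP[s0 s1].
have [||z Az zE] := @fconvex_comb A x x' (s * t) ((1 - s) * t') vA Ax Ax'.
- by rewrite mulr_ge0.
- by rewrite mulr_ge0 ?subr_ge0.
have [||w Dw wE] :=
  @fconvex_comb D y y' (s * (1 - t)) ((1 - s) * (1 - t')) vD Dy Dy'.
- by rewrite mulr_ge0 ?subr_ge0.
- by rewrite mulr_ge0 ?subr_ge0.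
exists (s * t + (1 - s) * t'), z, w; split => //; first by nra.
apply/funext => i; rewrite -zE.
rewrite (_ : 1 - (_ + _) = s * (1 - t) + (1 - s) * (1 - t')); last by ring.
by rewrite -wE; ring.
Qed.

Lemma join_compact A D : compact A -> compact D -> compact (join A D).
Proof.
move=> cA cD.
pose f (p : R * (RI * RI)) : RI :=
  fun i => p.1 * p.2.1 i + (1 - p.1) * p.2.2 i.
have -> : join A D = f @` (`[0, 1]%classic `*` (A `*` D)).
  apply/seteqP; split.
    by move=> _ [t [x [y [t01 Ax Dy ->]]]]; exists (t, (x, y)); rewrite //= in_itv.
  move=> _ [[t [x y]] [/= + [Ax Dy]] <-]; rewrite in_itv => t01.
  by exists t, x, y; split.
apply: continuous_compact; last first.
  by apply: compact_setX; [exact: segment_compact|exact: compact_setX].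
apply: continuous_subspaceT; apply: continuous_ptws => i.
have c1 : continuous (fun p : R * (RI * RI) => p.1).
  by move=> p; exact: cvg_fst.
have c2 : continuous (fun p : R * (RI * RI) => p.2.1 i).
  move=> p; apply: (@continuous_comp _ _ _ snd (fun q : RI * RI => q.1 i)).
    exact: cvg_snd.
  apply: (@continuous_comp _ _ _ fst (fun z : RI => z i)); first exact: cvg_fst.
  exact: coord_continuous.
have c3 : continuous (fun p : R * (RI * RI) => p.2.2 i).
  move=> p; apply: (@continuous_comp _ _ _ snd (fun q : RI * RI => q.2 i)).
    exact: cvg_snd.
  apply: (@continuous_comp _ _ _ snd (fun z : RI => z i)); first exact: cvg_snd.
  exact: coord_continuous.
apply: continuous_add; apply: continuous_mul => //.
apply: continuous_add; first exact: cst_continuous.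
exact: continuous_opp.
Qed.

(** * Milman's converse to the Krein-Milman theorem *)

Section Milman.
Variables (K : set RI) (u : I).
Hypotheses (cK : compact K) (vK : fconvex K) (uK : forall z, K z -> z u = 1).

(** The join is compact and convex and contains [F1] and [F2]. A functional separating [x] from it
    would be bounded on both sets by a constant that it exceeds at [x], against membership in the
    bipolar. *)
Lemma bipolar_setU F1 F2 x : F1 `<=` K -> F2 `<=` K ->
  F1 !=set0 -> F2 !=set0 -> K x -> bipolar (F1 `|` F2) x ->
  join (K `&` bipolar F1) (K `&` bipolar F2) x.
Proof.
move=> F1K F2K [x1 F1x1] [x2 F2x2] Kx Fx; set J := join _ _.
apply: contrapT => Jx.
have cI F : compact (K `&` bipolar F).
  by apply: compact_closedI => //; exact: bipolar_closed.
have vI F : fconvex (K `&` bipolar F).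
  by apply: fconvexI => //; exact: bipolar_convex.
have [l [b [lJ lx]]] := separation (join_compact (cI F1) (cI F2))
  (join_convex (vI F1) (vI F2)) Jx.
have mem z : (F1 `|` F2) z -> J z.
  case=> Fz.
    exists 1, z, x2; split; rewrite ?ler01 ?lexx //.
    - by split; [exact: F1K|exact: sub_bipolar].
    - by split; [exact: F2K|exact: sub_bipolar].
    by apply/funext => i; ring.
  exists 0, x1, z; split; rewrite ?ler01 ?lexx //.
  - by split; [exact: F1K|exact: sub_bipolar].
  - by split; [exact: F2K|exact: sub_bipolar].
  by apply/funext => i; ring.
(* Since [z u = 1] on [K], the coordinate [u] turns the affine bound [lin l z <= b] into a
   homogeneous one, which the bipolar can test. *)
pose l' := (b, u) :: [seq (- ci.1, ci.2) | ci <- l].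
have l'E z : z u = 1 -> lin l' z = b - lin l z.
  by move=> zu; rewrite lin_cons zu mulr1 lin_opp.
have : 0 <= lin l' x.
  apply: Fx => z Fz; rewrite l'E ?subr_ge0; first exact/lJ/mem.
  by apply: uK; case: Fz => [/F1K|/F2K].
by rewrite l'E ?uK // subr_ge0 leNgt lx.
Qed.

Lemma bipolar0 x : K x -> ~ bipolar set0 x.
Proof.
move=> Kx /(_ [:: (-1, u)]); rewrite lin_cons lin_nil uK // => /(_ _).
by move=> /(_ (fun _ => False_ind _)); lra.
Qed.

(** By [bipolar_setU], [x] is a convex combination of a point from each piece, and extremality makes
    it one of them. The weights 0 and 1 are treated apart because extremality speaks only of proper
    combinations. *)
Lemma extreme_bipolar_setU F1 F2 x : F1 `<=` K -> F2 `<=` K ->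
  fextreme (K `&` bipolar (F1 `|` F2)) x -> bipolar F1 x \/ bipolar F2 x.
Proof.
move=> F1K F2K [[Kx Fx] ex].
have [F10|/set0P/negP/negPn/eqP F10] := pselect (F1 !=set0); last first.
  by right; rewrite F10 set0U in Fx.
have [F20|/set0P/negP/negPn/eqP F20] := pselect (F2 !=set0); last first.
  by left; rewrite F20 setU0 in Fx.
have [t [y1 [y2 [/andP[t0 t1] [Ky1 Fy1] [Ky2 Fy2] xE]]]] :=
  bipolar_setU F1K F2K F10 F20 Kx Fx.
have [t0'|t0'] := eqVneq t 0.
  right; suff -> : x = y2 by [].
  by rewrite xE t0'; apply/funext => i; ring.
have [t1'|t1'] := eqVneq t 1.
  left; suff -> : x = y1 by [].
  by rewrite xE t1'; apply/funext => i; ring.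
left; have [] := ex y1 y2 t _ _ _ xE.
- by split => //; apply: bipolarS Fy1 => z; left.
- by split => //; apply: bipolarS Fy2 => z; right.
- by rewrite !lt_neqAle t0 t1 eq_sym t0' t1'.
by move=> <-.
Qed.

(** A coordinate at which [x] and [y] differ, shifted by the midpoint [c] of its two values, changes
    sign between them; the coordinate [u] supplies the constant. *)
Lemma functional_separation x y : K x -> K y -> x <> y ->
  exists l, lin l x < 0 /\ 0 < lin l y.
Proof.
move=> Kx Ky xy; have [i xyi] : exists i, x i != y i.
  apply: contrapT => n; apply: xy; apply/funext => i; apply/eqP.
  by apply: contrapT => /negP xyi; apply: n; exists i.
pose c : R := (x i + y i) / 2.
have [xlt|ylt|/eqP] := ltgtP (x i) (y i); last by rewrite (negbTE xyi).
  by exists [:: (1, i); (- c, u)]; rewrite !lin_cons !lin_nil !uK // /c; lra.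
by exists [:: (-1, i); (c, u)]; rewrite !lin_cons !lin_nil !uK // /c; lra.
Qed.

(* Milman's converse: the sets [F'] with [x] outside [bipolar F'] form an ideal,
   and every point of [F] other than [x] has a neighbourhood in it. *)
Lemma milman F x : closed F -> F `<=` K ->
  fextreme (K `&` bipolar F) x -> F x.
Proof.
move=> clF FK ex; have [[Kx Fx] _] := ex; apply: contrapT => nFx.
have kF : compact F by exact: subclosed_compact clF cK FK.
pose D : set {classic seq (R * I)} := [set l | lin l x < 0].
pose U (l : {classic seq (R * I)}) : set RI := [set z | 0 < lin l z].
have oU l : D l -> open (U l).
  move=> _; rewrite -[U l]setCK; apply: closed_openC.
  rewrite (_ : ~` U l = lin l @^-1` [set r | r <= 0]).
    have /continuous_closedP cl := @lin_continuous l.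
    exact: cl (@closed_le R 0).
  by apply/seteqP; split => z; rewrite /U /= leNgt => /negP.
have cov : F `<=` cover D U.
  move=> y Fy; have xy : x <> y by move=> xy; apply: nFx; rewrite xy.
  by have [l [lx ly]] := functional_separation Kx (FK _ Fy) xy; exists l.
have [s sD] := compact_finite_subcover kF (I := {classic seq (R * I)}) oU cov.
rewrite /cover/=.
have {sD} : forall l, l \in enum_fset s -> D l by move=> l /sD; rewrite inE.
have -> : \bigcup_(i in [set` s]) U i = \bigcup_(i in [set` enum_fset s]) U i by [].
(* Induction on the subcover, cutting [F] by [U l]. On the part inside [U l] the functional [l] is
   positive, whereas [lin l x < 0], so [x] lies in the bipolar of the remaining part and is still
   extreme there. *)
elim: (enum_fset s) F ex FK {nFx Fx clF kF cov} => [|l r IH] F ex FK sD sF.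
  have [[_ +] _] := ex; suff -> : F = set0 by exact: bipolar0.
  by apply/seteqP; split => // z /sF [].
have FE : F = (F `&` U l) `|` (F `\` U l) by rewrite setUIDK.
have s1 : F `&` U l `<=` K by move=> z [/FK].
have s2 : F `\` U l `<=` K by move=> z [/FK].
have := ex; rewrite {1}FE => /(extreme_bipolar_setU s1 s2)[Fx|Fx].
  have /= lx := sD l (mem_head _ _).
  have : 0 <= lin l x by apply: Fx => z [_ /ltW].
  by rewrite leNgt lx.
apply: (IH (F `\` U l)) => //.
- apply: fextreme_sub ex => //.
    by move=> z [Kz Fz]; split => //; apply: bipolarS Fz => w [].
- by move=> l' l'r; exact: sD (@mem_behead _ (l :: r) l' l'r).
move=> z [Fz nUz]; have [l' lr Ul'z] := sF _ Fz.
have : l' \in l :: r by exact: lr.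
rewrite in_cons => /orP[/eqP l'E|l'r]; last by exists l'.
by case: nUz; rewrite -l'E.
Qed.

End Milman.
End FunctionSpace.

(** * The lattice cone of measures on a pseudo effect algebra *)

Section States.
Variables (R : realType) (E : peaType).
Local Notation RE := {ptws pea_car E -> Real.sort R}.
Local Notation S := (@state_space R E).
Local Notation one := (pea_one E).
Implicit Types (f g p q v w x y s : RE) (F G : set RE).

Lemma is_measure_ge0 f a : is_measure f -> 0 <= f a.
Proof. by case. Qed.

Lemma measure_itv f a : is_measure f -> 0 <= f a <= f one.
Proof.
move=> [fD f0]; rewrite f0 /=; have [[d [ad _]] _] := pea_compl a.
by rewrite (fD _ _ _ ad) lerDl.
Qed.

Lemma measure_eq0 f : is_measure f -> f one = 0 -> f = (fun=> 0).
Proof.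
move=> mf f1; apply/funext => a; apply/eqP.
by rewrite eq_le andbC; have := measure_itv a mf; rewrite f1.
Qed.

Lemma measure_comb f g (s t : R) : is_measure f -> is_measure g ->
  0 <= s -> 0 <= t -> is_measure (fun a => s * f a + t * g a : R).
Proof.
move=> [fD f0] [gD g0] s0 t0; split => [a b c abc|a].
  by rewrite (fD _ _ _ abc) (gD _ _ _ abc); ring.
by rewrite addr_ge0 // mulr_ge0.
Qed.

Lemma measure_scale f (t : R) : is_measure f -> 0 <= t ->
  is_measure (fun a => t * f a : R).
Proof.
move=> [fD f0] t0; split => [a b c abc|a]; last by rewrite mulr_ge0.
by rewrite (fD _ _ _ abc); ring.
Qed.

Lemma measure_normalize f : is_measure f -> f one != 0 ->
  S (fun a => (f one)^-1 * f a).
Proof.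
move=> mf f1; split; last by rewrite mulVf.
by apply: measure_scale => //; rewrite invr_ge0; exact: is_measure_ge0.
Qed.

(** This turns the lattice hypothesis on the generated cone into one on measures. A nonzero measure
    is [f one] times a state; the zero measure is [0] times the given state [s0]. *)
Lemma gen_cone_states f : S !=set0 -> gen_cone S f <-> is_measure f.
Proof.
move=> [s0 Ss0]; split=> [[t [s [t0 [[ms _] ->]]]]|mf].
  exact: measure_scale.
have [f1|f1] := eqVneq (f one) 0.
  exists 0, s0; split; rewrite ?lexx //; split => //.
  by rewrite (measure_eq0 mf f1); apply/funext => a; rewrite mul0r.
exists (f one), (fun a => (f one)^-1 * f a); split; first exact: is_measure_ge0.
split; first exact: measure_normalize.
by apply/funext => a; rewrite mulrA mulfV ?mul1r.
Qed.

Lemma states_convex : fconvex S.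
Proof.
move=> x y t [mx x1] [my y1] /andP[t0 t1]; split; last by rewrite x1 y1; ring.
by apply: measure_comb; rewrite ?subr_ge0.
Qed.

Lemma closed_measures : closed [set f : RE | is_measure f].
Proof.
pose l3 (t : E * E * E) : seq (R * E) :=
  [:: (1, t.2); (-1, t.1.1); (-1, t.1.2)].
rewrite (_ : [set f | _] =
  (\bigcap_(t in [set t | pea_plus t.1.1 t.1.2 = Some t.2])
     [set f | lin (l3 t) f = 0]) `&`
  \bigcap_a [set f : RE | 0 <= lin [:: (1, a)] f]).
  apply: closedI; apply: closed_bigI => t _; first exact: closed_lin_eq.
  exact: closed_lin_ge.
apply/seteqP; split => f /= [fD f0]; split.
- by move=> [[a b] c] /= /fD; rewrite /l3 !lin_cons lin_nil /= => ->; ring.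
- by move=> a _; rewrite /= lin_cons lin_nil mul1r addr0.
- move=> a b c abc; have /= := fD (a, b, c) abc.
  by rewrite /l3 !lin_cons lin_nil /=; lra.
- by move=> a; have /= := f0 a I; rewrite lin_cons lin_nil mul1r addr0.
Qed.

(** Normalizing [v] and [x - v] writes [x] as a convex combination of two states with weight
    [v one]. At weight 0 or 1 one of the two measures vanishes. *)
Lemma extreme_dominated x v : ext_states x -> is_measure v ->
  is_measure (fun a => x a - v a : R) -> v = (fun a => v one * x a).
Proof.
move=> [[mx x1] ex] mv mxv; pose c := v one.
have c0 : 0 <= c by exact: is_measure_ge0.
have c1 : c <= 1 by have := is_measure_ge0 one mxv; rewrite x1 subr_ge0.
have [c00|c00] := eqVneq c 0.
  by rewrite -/c c00 (measure_eq0 mv c00); apply/funext => a; rewrite mul0r.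
have [c10|c10] := eqVneq c 1.
  rewrite -/c c10; apply/funext => a; rewrite mul1r.
  have := measure_eq0 mxv; rewrite x1 -/c c10 subrr => /(_ erefl) /(congr1 (@^~ a)).
  by move=> /eqP; rewrite subr_eq0 => /eqP.
have xv1 : x one - v one != 0 by rewrite x1 subr_eq0 eq_sym.
have [] := ex _ _ c (measure_normalize mv c00) (measure_normalize mxv xv1).
- by rewrite !lt_neqAle c0 c1 eq_sym c00 c10.
- apply/funext => a; rewrite x1 -/c; field.
  by rewrite c00 subr_eq0 eq_sym c10.
move=> vx _; apply/funext => a; rewrite -[in RHS]vx.
by rewrite mulrA mulfV ?mul1r.
Qed.

(** * Riesz decomposition, hereditary cones and orthogonality *)

Section Simplex.
Hypotheses (S0 : S !=set0) (cS : compact S) (latS : lattice_cone (gen_cone S)).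

Lemma measure_sup f g : is_measure f -> is_measure g -> exists u : RE,
  [/\ is_measure u, jle f u, jle g u &
    forall v, is_measure v -> jle f v -> jle g v -> jle u v].
Proof.
move=> mf mg; have [[u [Cu fu gu uP]] _] :=
  latS (proj2 (gen_cone_states _ S0) mf) (proj2 (gen_cone_states _ S0) mg).
exists u; split.
- exact/(gen_cone_states _ S0).
- exact/(gen_cone_states _ S0).
- exact/(gen_cone_states _ S0).
move=> v mv fv gv; apply/(gen_cone_states _ S0); apply: uP.
- exact/(gen_cone_states _ S0).
- exact/(gen_cone_states _ S0).
- exact/(gen_cone_states _ S0).
Qed.

Lemma jleE (f g h : E -> R) : is_measure h -> (forall a, h a = g a - f a) ->
  jle f g.
Proof. by move=> + hE; rewrite (_ : h = fun a => g a - f a) //; apply/funext. Qed.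

(** With [u] the supremum of [w] and [p], take [w1 = w + p - u], which is their infimum, and
    [w2 = u - p]. Then [w2] is below [q] because [p + q] is an upper bound of [w] and [p]. *)
Lemma riesz_decomposition w p q : is_measure w -> is_measure p ->
  is_measure q -> jle w (fun a => p a + q a : R) ->
  exists w1 w2 : RE, [/\ is_measure w1, is_measure w2, jle w1 p, jle w2 q &
    w = (fun a => w1 a + w2 a)].
Proof.
move=> mw mp mq wpq; have [u [mu wu pu uP]] := measure_sup mw mp.
exists (fun a => w a + p a - u a), (fun a => u a - p a); split => //.
- suff : jle u (fun a => w a + p a) by [].
  apply: uP.
  + have := measure_comb mw mp ler01 ler01.
    by congr is_measure; apply/funext => a; ring.
  + by apply: (jleE mp) => a; ring.
  + by apply: (jleE mw) => a; ring.
- by apply: (jleE wu) => a; ring.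
- have /(jleE (f := fun a => u a - p a) (g := q)) : is_measure
    (fun a => (p a + q a) - u a : R).
    apply: uP => //.
    + have := measure_comb mp mq ler01 ler01.
      by congr is_measure; apply/funext => a; ring.
    + by apply: (jleE mq) => a; ring.
  by apply => a; ring.
by apply/funext => a; ring.
Qed.

Lemma bipolar_scale F v (t : R) : bipolar F v -> 0 <= t ->
  bipolar F (fun a => t * v a).
Proof.
move=> Fv t0; have := bipolar_comb Fv Fv t0 (lexx 0).
by congr bipolar; apply/funext => a; ring.
Qed.

(** Pairs [(v, p)] with [v] below the state [p], coded as one function on a disjoint sum so that
    [extreme_min] applies to them. *)
Definition dominated_pairs F : set {ptws (E + E)%type -> Real.sort R} :=
  [set f | [/\ is_measure (fun a => f (inl a)),
     is_measure (fun a => f (inr a) - f (inl a)) &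
     (S `&` bipolar F) (fun a => f (inr a))]].

(** A state has values in the unit interval, and so has any measure below it; the pairs thus form a
    closed subset of a Tychonoff cube. *)
Lemma dominated_pairs_compact F : compact (dominated_pairs F).
Proof.
have cube : compact [set f : {ptws (E + E)%type -> Real.sort R} |
    forall i, `[0, 1]%classic (f i)].
  exact: (@tychonoff {classic (E + E)} (fun=> R : topologicalType)
    (fun=> `[0, 1]%classic) (fun=> @segment_compact R 0 1)).
apply: (subclosed_compact _ cube); last first.
  move=> f [ml mrl [[mr r1] _]] [] a; rewrite /= in_itv /=.
    have /andP[-> h] /= := measure_itv a ml; apply: (le_trans h).
    by have := is_measure_ge0 one mrl; rewrite r1 subr_ge0.
  by rewrite -r1; exact: (measure_itv a mr).
pose rl (f : {ptws (E + E)%type -> Real.sort R}) : RE := fun a => f (inl a).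
pose rr (f : {ptws (E + E)%type -> Real.sort R}) : RE := fun a => f (inr a).
pose rd (f : {ptws (E + E)%type -> Real.sort R}) : RE :=
  fun a => f (inr a) - f (inl a).
have crl : continuous rl by apply: continuous_ptws => a; exact: coord_continuous.
have crr : continuous rr by apply: continuous_ptws => a; exact: coord_continuous.
have crd : continuous rd.
  apply: continuous_ptws => a; apply: continuous_add.
    exact: coord_continuous.
  apply: continuous_opp; exact: coord_continuous.
have -> : dominated_pairs F = (rl @^-1` [set f | is_measure f]) `&`
    (rd @^-1` [set f | is_measure f]) `&` (rr @^-1` (S `&` bipolar F)).
  by apply/seteqP; split => [f [? ? ?]|f [[? ?] ?]].
move/continuous_closedP in crl; move/continuous_closedP in crr.
move/continuous_closedP in crd.
apply: closedI; first by apply: closedI; [apply: crl|apply: crd]; exact: closed_measures.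
apply: crr; apply: closedI; last exact: bipolar_closed.
exact: (compact_closed (@ptws_hausdorff R E)).
Qed.

(* By the Riesz decomposition property, an extreme dominated pair [(v, p)] has
   [p] extreme, hence in [F] by Milman, and then [v] is a multiple of [p]. *)
Lemma bipolar_dominated_state F p v : closed F -> F `<=` ext_states (R := R) (E := E) ->
  (S `&` bipolar F) p -> is_measure v -> jle v p -> bipolar F v.
Proof.
move=> clF FX Fp mv vp l lF.
have FS : F `<=` S by move=> x /FX [].
(* [l2] applies [l] to the first component of a pair. It attains its minimum at an extreme pair [e],
   where nonnegativity will be checked. *)
pose l2 : seq (R * (E + E)) := [seq (ci.1, inl ci.2) | ci <- l].
have l2E (f : {ptws (E + E)%type -> Real.sort R}) :
  lin l2 f = lin l (fun a => f (inl a)) by rewrite /lin big_map.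
pose f0 : {ptws (E + E)%type -> Real.sort R} :=
  fun i => match i with inl a => v a | inr a => p a end.
have Tf0 : dominated_pairs F f0 by [].
have [|e [Te exe] emin] := extreme_min l2 (@dominated_pairs_compact F).
  by exists f0.
suff h : 0 <= lin l2 e.
  have : 0 <= lin l2 f0 by exact: le_trans h (emin _ Tf0).
  by rewrite l2E.
rewrite l2E; have [ml mrl Fr] := Te.
set v' := (fun a => e (inl a)) in ml mrl *; set p' := (fun a => e (inr a)) in mrl Fr.
have extp : fextreme (S `&` bipolar F) p'.
  split => // p1 p2 t Fp1 Fp2 /andP[t0 t1] p'E.
  have t1' : 0 < 1 - t by rewrite subr_gt0.
  have [mp1 _] := Fp1.1; have [mp2 _] := Fp2.1.
  have [|w1 [w2 [mw1 mw2 wp1 wp2 wE]]] := riesz_decomposition ml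
    (measure_scale mp1 (ltW t0)) (measure_scale mp2 (ltW t1')).
    by rewrite -p'E; exact: mrl.
  (* Riesz decomposition has split [v'] below [t * p1] and [(1 - t) * p2]. Rescaled by the weights,
     the pieces form dominated pairs over [p1] and [p2] whose combination is [e]. *)
  pose e1 : {ptws (E + E)%type -> Real.sort R} :=
    fun i => match i with inl a => t^-1 * w1 a | inr a => p1 a end.
  pose e2 : {ptws (E + E)%type -> Real.sort R} :=
    fun i => match i with inl a => (1 - t)^-1 * w2 a | inr a => p2 a end.
  have Te1 : dominated_pairs F e1.
    split => //; first by apply: measure_scale => //; rewrite invr_ge0 ltW.
    have := measure_scale (t := t^-1) wp1; rewrite invr_ge0 ltW // => /(_ isT).
    congr is_measure; apply/funext => a /=.
    by rewrite mulrBr mulrA mulVf ?mul1r // gt_eqF.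
  have Te2 : dominated_pairs F e2.
    split => //; first by apply: measure_scale => //; rewrite invr_ge0 ltW.
    have := measure_scale (t := (1 - t)^-1) wp2; rewrite invr_ge0 ltW // => /(_ isT).
    congr is_measure; apply/funext => a /=.
    by rewrite mulrBr mulrA mulVf ?mul1r // gt_eqF.
  have [||e1E e2E] := exe _ _ t Te1 Te2; first by rewrite t0.
    apply/funext => -[a|a]; last by rewrite -/(p' a) p'E.
    rewrite -/(v' a) wE /= !mulrA !mulfV ?mul1r //; by rewrite gt_eqF.
  by split; apply/funext => a; [rewrite /p' -e1E|rewrite /p' -e2E].
have /(milman cS states_convex (fun z Sz => Sz.2) clF FS) Fp' := extp.
rewrite (extreme_dominated (FX _ Fp') ml mrl).
rewrite (_ : (fun a => _) = (fun a => v' one * p' a + 0 * p' a)).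
  by rewrite lin_comb mul0r addr0 mulr_ge0 ?lF //; exact: is_measure_ge0.
by apply/funext => a; ring.
Qed.

Lemma bipolar_dominated F p v : closed F -> F `<=` ext_states (R := R) (E := E) ->
  is_measure p -> bipolar F p -> is_measure v -> jle v p -> bipolar F v.
Proof.
move=> clF FX mp Fp mv vp; have p0 : 0 <= p one by exact: is_measure_ge0.
have [p1|p1] := eqVneq (p one) 0.
  have -> : v = p; last by [].
  rewrite (measure_eq0 mp p1) (measure_eq0 mv) //; apply/eqP.
  rewrite eq_le (is_measure_ge0 _ mv) andbT.
  by have := is_measure_ge0 one vp; rewrite p1 subr_ge0.
have p1i : 0 <= (p one)^-1 by rewrite invr_ge0.
have Fv : bipolar F (fun a => (p one)^-1 * v a).
  apply: (@bipolar_dominated_state F (fun a => (p one)^-1 * p a)) => //.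
  - by split; [exact: measure_normalize|exact: bipolar_scale].
  - exact: measure_scale.
  by apply: (jleE (measure_scale vp p1i)) => a; ring.
have := bipolar_scale Fv p0; congr bipolar; apply/funext => a.
by rewrite mulrA mulfV ?mul1r.
Qed.

(* If [w], the infimum of [p] and [q], is not zero, then [H] below is a nonempty
   closed face of [S], and its extreme points are in [F] and in [G] by Milman. *)
Lemma bipolar_disjoint F G p q s : closed F -> closed G ->
  F `<=` ext_states (R := R) (E := E) -> G `<=` ext_states (R := R) (E := E) ->
  F `&` G = set0 -> is_measure p -> is_measure q -> bipolar F p -> bipolar G q ->
  is_measure s -> jle p s -> jle q s -> jle (fun a => p a + q a : R) s.
Proof.
move=> clF clG FX GX FG mp mq Fp Gq ms ps qs.
have [u [mu pu qu uP]] := measure_sup mp mq.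
(* [w] is the infimum of [p] and [q]. Once it vanishes, [p + q] equals the supremum [u], which is
   below [s]. *)
pose w : RE := fun a => p a + q a - u a.
have mpq : is_measure (fun a => p a + q a : R).
  have := measure_comb mp mq ler01 ler01.
  by congr is_measure; apply/funext => a; ring.
have mw : is_measure w.
  apply: uP => //; first by apply: (jleE mq) => a; ring.
  by apply: (jleE mp) => a; ring.
have wp : jle w p by apply: (jleE qu) => a; rewrite /w; ring.
have wq : jle w q by apply: (jleE pu) => a; rewrite /w; ring.
have Fw := bipolar_dominated clF FX mp Fp mw wp.
have Gw := bipolar_dominated clG GX mq Gq mw wq.
suff w0 : w = (fun=> 0).
  apply: (jleE (uP _ ms ps qs)) => a.
  by have := congr1 (@^~ a) w0; rewrite /w /=; lra.
have [w1|w1] := eqVneq (w one) 0; first exact: measure_eq0.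
exfalso.
have w1i : 0 <= (w one)^-1 by rewrite invr_ge0; exact: is_measure_ge0.
pose H := S `&` (bipolar F `&` bipolar G).
have cH : compact H.
  by apply: compact_closedI => //; apply: closedI; exact: bipolar_closed.
have [|e [He exe] _] := extreme_min [::] cH.
  exists (fun a => (w one)^-1 * w a); split; first exact: measure_normalize.
  by split; exact: bipolar_scale.
have [Se [Fe Ge]] := He.
(* [H] is a face of [S]: a component [t * x] of [e] is a measure below [e], so heredity puts it in
   both cones. *)
have part (x y : RE) (t : R) : S x -> S y -> 0 < t -> 0 <= 1 - t ->
    e = (fun a => t * x a + (1 - t) * y a) -> H x.
  move=> Sx Sy t0 t1 eE.
  have txe : jle (fun a => t * x a) e.
    by apply: (jleE (measure_scale Sy.1 t1)) => a; rewrite eE; ring.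
  have mtx := measure_scale Sx.1 (ltW t0).
  have xE : x = (fun a => t^-1 * (t * x a)).
    by apply/funext => a; rewrite mulrA mulVf ?mul1r // gt_eqF.
  split => //; split; rewrite xE; apply: bipolar_scale; rewrite ?invr_ge0 ?ltW //.
    exact: bipolar_dominated clF FX Se.1 Fe mtx txe.
  exact: bipolar_dominated clG GX Se.1 Ge mtx txe.
have exS : fextreme S e.
  split => // x y t Sx Sy /andP[t0 t1] eE; apply: (exe x y t) => //; last 1 first.
  - by rewrite t0.
  - by apply: (part x y t) => //; rewrite ?subr_ge0 ltW.
  apply: (part y x (1 - t)) => //; rewrite ?subr_gt0 ?subKr ?ltW //.
  by rewrite eE; apply/funext => a; ring.
have FS : F `<=` S by move=> x /FX [].
have GS : G `<=` S by move=> x /GX [].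
have : (F `&` G) e; last by rewrite FG.
split.
  apply: (milman cS states_convex (fun z Sz => Sz.2) clF FS).
  by apply: fextreme_sub exS => // z [].
apply: (milman cS states_convex (fun z Sz => Sz.2) clG GS).
by apply: fextreme_sub exS => // z [].
Qed.

End Simplex.
End States.

(** * Representation by finitely additive probabilities *)

(** Defined on all subsets, so that these functions form a closed subset of a product of unit
    intervals. *)
Record finitely_additive_probability (R : realType) (T : Type) (m : set T -> R)
  : Prop := FinitelyAdditiveProbability {
  faprob_ge0 : forall A, 0 <= m A;
  faprobU : forall A B, A `&` B = set0 -> m (A `|` B) = m A + m B;
  faprobT : m setT = 1 }.

Section FinitelyAdditive.
Variables (R : realType) (T : Type) (m : set T -> R).
Hypothesis mP : finitely_additive_probability m.
Implicit Types A B : set T.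

Lemma faprob_le A B : A `<=` B -> m A <= m B.
Proof.
move=> AB; rewrite -(setUIDK B A) (setIidr AB) faprobU ?lerDl ?faprob_ge0 //.
by apply/seteqP; split => // x [Ax [_]].
Qed.

Lemma faprob_le1 A : m A <= 1.
Proof. by rewrite -(faprobT mP); exact: faprob_le. Qed.

Lemma faprobU_le A B : m (A `|` B) <= m A + m B.
Proof.
have -> : A `|` B = A `|` (B `\` A)
  by apply/seteqP; split => x; [case: (pselect (A x)) => ? []|case=> [|[]]];
    [left|left|left|right|left|right].
rewrite faprobU //; last by apply/seteqP; split => // x [Ax [_]].
by rewrite lerD2l; apply: faprob_le => x [].
Qed.

End FinitelyAdditive.

Section LayerCake.
Variable R : realType.

(** The sum counts the integers from 1 to [n] that are at most [y]. It is therefore at most [y], and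
    misses it by at most 1 when [y <= n%:R]. *)
Lemma layer_sum_le n (y : R) : 0 <= y ->
  \sum_(k < n) (k.+1%:R <= y)%R%:R <= y.
Proof.
move=> y0; elim: n => [|n IH]; first by rewrite big_ord0.
rewrite big_ord_recr /=; case: (lerP n.+1%:R y) => [ny|_]; last by rewrite addr0.
rewrite (le_trans _ ny) // -[in X in _ <= X]natr1 lerD2r.
rewrite (le_trans (ler_sum _ (G := fun=> 1) _)) ?sumr_const ?card_ord //.
by move=> k _; rewrite lern1 leq_b1.
Qed.

Lemma layer_sum_ge n (y : R) : y <= n%:R ->
  y <= \sum_(k < n) (k.+1%:R <= y)%R%:R + 1.
Proof.
elim: n => [|n IH] yn; first by rewrite big_ord0 add0r (le_trans yn).
rewrite big_ord_recr /=; case: (lerP y n%:R) => [yn'|ny].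
  by rewrite (le_trans (IH yn')) // lerD2r lerDl.
apply: (le_trans yn); rewrite -natr1 lerD2r.
rewrite (eq_bigr (fun=> 1)) => [|k _]; last first.
  by rewrite (le_trans _ (ltW ny)) // ler_nat.
by rewrite sumr_const card_ord lerDl.
Qed.

End LayerCake.

Section Choquet.
Variables (R : realType) (E : peaType).
Local Notation RE := {ptws pea_car E -> Real.sort R}.
Local Notation S := (@state_space R E).
Local Notation X := (@ext_states R E).
Local Notation RZ := {ptws (pea_car E + set RE)%type -> Real.sort R}.

(** For [n > 0] these are the level sets of [x a] at height [(k + 1) / n]. For a state [x], the
    indicators over [k < n] add up to the integer part of [n%:R * x a]. *)
Definition layer (a : E) (n k : nat) : set RE := [set x | k.+1%:R <= n%:R * x a].

(* [n * s a <= \sum_k m (layer a n k) + 1] says that [s a] is at most the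
   integral of [x a] against [m], up to [1 / n]. *)
Definition represented : set RZ := [set f |
  [/\ S (fun a => f (inl a)),
      finitely_additive_probability (fun A => f (inr A)),
      f (inr X) = 1 &
      forall a n, n%:R * f (inl a) <= \sum_(k < n) f (inr (layer a n k)) + 1]].

Lemma represented_convex : fconvex represented.
Proof.
move=> f g t [Sf [f0 fU fT] fX fL] [Sg [g0 gU gT] gX gL] t01.
have /andP[t0 t1] := t01; have t1' : 0 <= 1 - t by rewrite subr_ge0.
split.
- exact: (states_convex Sf Sg).
- split => [A|A B AB|].
  + by rewrite addr_ge0 // mulr_ge0.
  + by rewrite fU // gU //; ring.
  + by rewrite fT gT; ring.
- by rewrite fX gX; ring.
move=> a n; rewrite big_split /= -!mulr_sumr.
have := ler_wpM2l t0 (fL a n); have := ler_wpM2l t1' (gL a n); lra.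
Qed.

(** Apart from the closed condition on the state, each requirement is an equality or a weak
    inequality between finitely many coordinates, so the set is closed in a Tychonoff cube. *)
Lemma represented_compact : compact S -> compact represented.
Proof.
move=> cS.
have cube : compact [set f : RZ | forall i, `[0, 1]%classic (f i)].
  exact: (@tychonoff {classic (E + set RE)} (fun=> R : topologicalType)
    (fun=> `[0, 1]%classic) (fun=> @segment_compact R 0 1)).
apply: (subclosed_compact _ cube); last first.
  move=> f [[ml f1] fa _ _] [a|A]; rewrite /= in_itv /=.
    by rewrite -f1; exact: (measure_itv a ml).
  by rewrite (faprob_ge0 fa) (faprob_le1 fa).
pose fl (f : RZ) : RE := fun a => f (inl a).
have cfl : continuous fl by apply: continuous_ptws => a; exact: coord_continuous.
move/continuous_closedP in cfl.
pose lU (AB : set RE * set RE) : seq (R * (E + set RE)) :=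
  [:: (1, inr (AB.1 `|` AB.2)); (-1, inr AB.1); (-1, inr AB.2)].
pose lL (an : E * nat) : seq (R * (E + set RE)) :=
  (- an.2%:R, inl an.1) :: [seq (1, inr (layer an.1 an.2 (val k))) | k <- enum 'I_an.2].
have -> : represented = (fl @^-1` S) `&`
  (\bigcap_A [set f : RZ | 0 <= lin [:: (1, inr A)] f]) `&`
  (\bigcap_(AB in [set AB | AB.1 `&` AB.2 = set0]) [set f : RZ | lin (lU AB) f = 0]) `&`
  [set f : RZ | lin [:: (1, inr setT)] f = 1] `&`
  [set f : RZ | lin [:: (1, inr X)] f = 1] `&`
  (\bigcap_an [set f : RZ | - 1 <= lin (lL an) f]).
  have l1 i (f : RZ) : lin [:: (1, i)] f = f i.
    by rewrite lin_cons lin_nil mul1r addr0.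
  have lLE a n (f : RZ) :
      lin (lL (a, n)) f = \sum_(k < n) f (inr (layer a n k)) - n%:R * f (inl a).
    rewrite lin_cons /= /lin big_map big_enum /= addrC mulNr; congr (_ - _).
    by apply: eq_bigr => k _; rewrite mul1r.
  apply/seteqP; split => f.
    move=> [Sf [f0 fU fT] fX fL]; split; [split; [split; [split; [split|]|]|]|].
    - by [].
    - by move=> A _; rewrite /= l1.
    - by move=> [A B] /= AB; rewrite /lU !lin_cons lin_nil /= fU //; ring.
    - by rewrite /= l1.
    - by rewrite /= l1.
    - by move=> [a n] _; rewrite /= lLE; have := fL a n; lra.
  move=> [[[[[Sf f0] fU] fT] fX] fL]; rewrite /= l1 in fT; rewrite /= l1 in fX.
  split => //; first split => //.
  - by move=> A; have := f0 A I; rewrite /= l1.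
  - move=> A B AB; have := fU (A, B) AB; rewrite /= /lU !lin_cons lin_nil /=; lra.
  - move=> a n; have := fL (a, n) I; rewrite /= lLE; lra.
apply: closedI; last by apply: closed_bigI => A _; exact: closed_lin_ge.
apply: closedI; last exact: closed_lin_eq.
apply: closedI; last exact: closed_lin_eq.
apply: closedI; last by apply: closed_bigI => A _; exact: closed_lin_eq.
apply: closedI; last by apply: closed_bigI => A _; exact: closed_lin_ge.
exact: (cfl S (compact_closed (@ptws_hausdorff R E) cS)).
Qed.

(** The states that are represented form a compact convex set [D]. It contains every extreme state,
    by a Dirac mass, so no functional separates [s] from it. *)
Lemma faprob_representation (s : RE) : compact S -> S s ->
  exists m : set RE -> R, [/\ finitely_additive_probability m, m X = 1 &
    forall a n, n%:R * s a <= \sum_(k < n) m (layer a n k) + 1].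
Proof.
move=> cS Ss.
pose fl (f : RZ) : RE := fun a => f (inl a).
pose D := fl @` represented.
suff [f [Sf fa fX fL] <-] : D s by exists (fun A => f (inr A)).
apply: contrapT => Ds.
have cD : compact D.
  apply: continuous_compact; last exact: represented_compact.
  apply: continuous_subspaceT; apply: continuous_ptws => a.
  exact: coord_continuous.
have vD : fconvex D.
  move=> _ _ t [f Zf <-] [g Zg <-] t01.
  by exists (fun i => t * f i + (1 - t) * g i) => //; exact: represented_convex.
have [l [b [lD ls]]] := separation cD vD Ds.
(* Minimizing the negated functional yields an extreme state [e] maximizing [lin l] on [S]. *)
have [|e Xe emin] := extreme_min [seq (- ci.1, ci.2) | ci <- l] cS; first by exists s.
have : lin l e <= b.
  (* The Dirac mass at [e] represents [e]: [layer_sum_ge] with [y] equal to [n%:R * e a] is the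
     required estimate. *)
  apply: lD; exists (fun i => match i with inl a => e a | inr A => \1_A e end) => //.
  split.
  - by case: Xe.
  - split => [A|A B AB|]; rewrite ?indicE ?ler0n //.
    + rewrite in_setU -natrD; congr (_%:R).
      case: (boolP (e \in A)) => //= /set_mem eA.
      by rewrite memNset // => eB; have : (A `&` B) e by []; rewrite AB.
    + by rewrite in_setT.
  - by rewrite indicE mem_set.
  move=> a n.
  have /andP[e0 e1] := measure_itv a Xe.1.1.
  have /layer_sum_ge : n%:R * e a <= n%:R by rewrite ler_piMr // -Xe.1.2.
  move=> /le_trans; apply; rewrite lerD2r ler_sum // => k _.
  rewrite indicE; case: (lerP k.+1%:R) => //= ek; first by rewrite mem_set.
have := emin _ Ss; rewrite !lin_opp lerN2 => h1 h2; move: ls.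
by rewrite ltNge (le_trans h1 h2).
Qed.

End Choquet.

(** * Regular Borel measures from finitely additive probabilities *)

Section RegularBorelExtension.
Variables (R : realType) (T : ptopologicalType) (m : set T -> R).
Hypotheses (hT : hausdorff_space T) (cT : compact [set: T]).
Hypothesis mP : finitely_additive_probability m.
Implicit Types A B K L U V W : set T.

(** Only the values of [m] on closed sets are kept; on an open set the result may be smaller than
    [m U]. *)
Definition inner_content U : R := sup [set m K | K in [set K | closed K /\ K `<=` U]].

Lemma inner_content_ge K U : closed K -> K `<=` U -> m K <= inner_content U.
Proof.
move=> cK KU; apply: ub_le_sup; last by exists K.
by exists 1 => _ [L _ <-]; exact: faprob_le1.
Qed.

Lemma inner_content_le U c : (forall K, closed K -> K `<=` U -> m K <= c) ->
  inner_content U <= c.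
Proof.
move=> h; apply: ge_sup.
  by exists (m set0), set0 => //; split => //; exact: closed0.
by move=> _ [K [cK KU] <-]; exact: h.
Qed.

Lemma inner_contentS U V : U `<=` V -> inner_content U <= inner_content V.
Proof.
move=> UV; apply: inner_content_le => K cK KU; apply: inner_content_ge => //.
exact: subset_trans UV.
Qed.

Lemma inner_content_ge0 U : 0 <= inner_content U.
Proof.
apply: le_trans (inner_content_ge (@closed0 T) (@sub0set _ U)).
exact: faprob_ge0.
Qed.

(** By normality a closed [K] inside the union is covered by two closed sets, one inside [U] and one
    inside [V]; [m] is subadditive on them. *)
Lemma inner_contentU U V : open U -> open V ->
  inner_content (U `|` V) <= inner_content U + inner_content V.
Proof.
move=> oU oV; apply: inner_content_le => K cK KUV.
have cKV : closed (K `\` V) by apply: closedI => //; exact: open_closedC.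
have nU : set_nbhs (K `\` V) U.
  move=> x [Kx nVx]; apply: open_nbhs_nbhs; split => //.
  by case: (KUV _ Kx).
have [B BKV BU] := compact_normal hT cT cKV nU.
have -> : K = (K `&` closure B) `|` (K `\` B^°).
  apply/seteqP; split => [x Kx|x [[]|[]]] //.
  have [Bx|Bx] := pselect (B x).
    by left; split => //; exact: subset_closure.
  by right; split => // /interior_subset.
apply: (le_trans (faprobU_le mP _ _)); apply: lerD; apply: inner_content_ge.
- by apply: closedI => //; exact: closed_closure.
- by move=> x [_ /BU].
- by apply: closedI => //; apply: open_closedC; exact: open_interior.
move=> x [Kx nBx]; apply: contrapT => nVx; apply: nBx.
exact: (BKV x).
Qed.

Lemma inner_content_bigU (U : nat -> set T) n : (forall i, open (U i)) ->
  inner_content (\big[setU/set0]_(i < n) U i) <= \sum_(i < n) inner_content (U i).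
Proof.
move=> oU; elim: n => [|n IH].
  rewrite !big_ord0; apply: inner_content_le => K _.
  rewrite subset0 => ->; have := faprobU mP (A := set0) (B := set0).
  by rewrite setI0 setU0 => /(_ erefl); lra.
rewrite !big_ord_recr /=; apply: (le_trans (inner_contentU _ _)) => //.
  by rewrite -bigcup_mkord; exact: bigcup_open.
by rewrite lerD2r.
Qed.

Definition outer_content A : R :=
  inf [set inner_content U | U in [set U | open U /\ A `<=` U]].

Lemma outer_content_le A U : open U -> A `<=` U -> outer_content A <= inner_content U.
Proof.
move=> oU AU; apply: ge_inf; last by exists U.
by exists 0 => _ [V _ <-]; exact: inner_content_ge0.
Qed.

Lemma outer_content_ge A c :
  (forall U, open U -> A `<=` U -> c <= inner_content U) -> c <= outer_content A.
Proof.
move=> h; apply: lb_le_inf.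
  by exists (inner_content setT), setT; split => //; exact: openT.
by move=> _ [U [oU AU] <-]; exact: h.
Qed.

Lemma outer_contentS A B : A `<=` B -> outer_content A <= outer_content B.
Proof.
move=> AB; apply: outer_content_ge => U oU BU; apply: outer_content_le => //.
exact: subset_trans BU.
Qed.

Lemma outer_content_open U : open U -> outer_content U = inner_content U.
Proof.
move=> oU; apply/eqP; rewrite eq_le outer_content_le //=.
by apply: outer_content_ge => V oV; exact: inner_contentS.
Qed.

Lemma outer_content_closed K : closed K -> m K <= outer_content K.
Proof. by move=> cK; apply: outer_content_ge => U oU; exact: inner_content_ge. Qed.

Lemma outer_content_ge0 A : 0 <= outer_content A.
Proof. by apply: outer_content_ge => U _ _; exact: inner_content_ge0. Qed.

Lemma outer_contentT : outer_content setT = 1.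
Proof.
rewrite outer_content_open; last exact: openT.
apply/eqP; rewrite eq_le; apply/andP; split.
  by apply: inner_content_le => K _ _; exact: faprob_le1.
rewrite -(faprobT mP); apply: inner_content_ge => //; exact: closedT.
Qed.

Lemma outer_content_adherent A (e : R) : 0 < e ->
  exists U, [/\ open U, A `<=` U & inner_content U <= outer_content A + e].
Proof.
move=> e0; have [|_ [U [oU AU] <-] /ltW h] := @inf_adherent _
    [set inner_content U | U in [set U | open U /\ A `<=` U]] e e0.
  split; first by exists (inner_content setT), setT; split => //; exact: openT.
  by exists 0 => _ [V _ <-]; exact: inner_content_ge0.
by exists U.
Qed.

Definition outer_ext A : \bar R := (outer_content A)%:E.

Lemma outer_ext0 : outer_ext set0 = 0%E.
Proof.
rewrite /outer_ext outer_content_open; last exact: open0.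
congr (_%:E); apply/eqP; rewrite eq_le inner_content_ge0 andbT.
have := @inner_content_bigU (fun=> set0) 0 (fun=> open0).
by rewrite !big_ord0.
Qed.

Lemma outer_ext_ge0 A : (0 <= outer_ext A)%E.
Proof. by rewrite lee_fin outer_content_ge0. Qed.

Lemma le_outer_ext : {homo outer_ext : A B / A `<=` B >-> (A <= B)%E}.
Proof. by move=> A B AB; rewrite lee_fin outer_contentS. Qed.

(** Enclose each [A n] in an open [U n] with error [e / 2 ^ n.+1]. A closed set inside the union of
    the [U n] is compact, so finitely many of them bound its content. *)
Lemma outer_ext_sigma_subadditive : sigma_subadditive outer_ext.
Proof.
move=> A; apply/lee_addgt0Pr => e e0.
apply: le_trans (epsilon_trick xpredT (fun n => outer_ext_ge0 (A n)) (ltW e0)).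
have /choice[U UP] : forall n, exists U, [/\ open U, A n `<=` U &
    inner_content U <= outer_content (A n) + e / (2 ^ n.+1)%:R].
  move=> n; apply: outer_content_adherent.
  by rewrite divr_gt0 // ltr0n expn_gt0.
have oU n : open (U n) by case: (UP n).
apply: (@le_trans _ _ (inner_content (\bigcup_n U n))%:E).
  rewrite lee_fin outer_content_le //; first exact: bigcup_open.
  by move=> x [n _ Ax]; exists n => //; have [_ AU _] := UP n; exact: AU.
set s := limn _.
have U0 n : (0 <= (inner_content (U n))%:E)%E by rewrite lee_fin inner_content_ge0.
apply: (@le_trans _ _ (\sum_(n <oo) (inner_content (U n))%:E)%E); last first.
  apply: lee_nneseries => // n _.
  by rewrite -EFinD lee_fin; have [] := UP n.
have key K : closed K -> K `<=` \bigcup_n U n ->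
    ((m K)%:E <= \sum_(n <oo) (inner_content (U n))%:E)%E.
  move=> cK KU; have kK : compact K by exact: subclosed_compact cK cT _.
  have [D _ KD] := compact_finite_subcover kK (I := nat) (fun n _ => oU n) KU.
  pose N := (\max_(n <- enum_fset D) n).+1.
  apply: (@le_trans _ _ (\sum_(n < N) (inner_content (U n))%:E)%E).
    rewrite sumEFin lee_fin; apply: le_trans (inner_content_bigU N oU).
    apply: inner_content_ge => // x /KD[n /= nD Ux].
    rewrite -bigcup_mkord; exists n => //=.
    by rewrite ltnS; apply: (@leq_bigmax_seq _ _ xpredT id).
  rewrite -(big_mkord xpredT (fun n => (inner_content (U n))%:E)).
  exact: nneseries_lim_ge.
case E : (\sum_(n <oo) (inner_content (U n))%:E)%E key => [r| |] key.
- by rewrite lee_fin; apply: inner_content_le => K cK KU; rewrite -lee_fin key.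
- by rewrite leey.
have := nneseries_ge0 (P := xpredT) (N := 0%N) (fun n _ _ => U0 n).
by rewrite E.
Qed.

HB.instance Definition _ := isOuterMeasure.Build R T outer_ext outer_ext0
  outer_ext_ge0 le_outer_ext outer_ext_sigma_subadditive.

(** For open [W] containing [A], take a closed [K] in the part of [W] inside [U], then a closed [L]
    in [W] minus [K]. They are disjoint, so [m K + m L] is at most the inner content of [W]; suprema
    over [L] and then [K] give the inequality. *)
Lemma open_caratheodory U : open U -> caratheodory_measurable outer_ext U.
Proof.
move=> oU; apply: le_caratheodory_measurable => A.
rewrite -EFinD lee_fin; apply: outer_content_ge => W oW AW.
rewrite -lerBrDr; apply: (@le_trans _ _ (inner_content (W `&` U))).
  apply: outer_content_le; first exact: openI.
  by apply: setSI.
apply: inner_content_le => K cK KWU.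
rewrite lerBrDr -lerBrDl.
apply: (@le_trans _ _ (inner_content (W `\` K))).
  apply: outer_content_le; first by apply: openI => //; exact: closed_openC.
  by move=> x [Ax nUx]; split; [exact: AW|move=> /KWU []].
apply: inner_content_le => L cL LWK.
rewrite lerBrDl -(faprobU mP).
  apply: inner_content_ge; first exact: closedU.
  by move=> x [/KWU []|/LWK []].
by apply/seteqP; split => // x [Kx /LWK []].
Qed.

Local Notation BT := (g_sigma_algebraType (@open T)).

Lemma borel_caratheodory (A : set BT) : measurable A ->
  measurable (A : set (caratheodory_type outer_ext)).
Proof.
apply: smallest_sub; last by move=> U oU; exact: open_caratheodory.
split.
- exact: measurable0.
- by move=> B mB; rewrite setTD; exact: measurableC.
- by move=> F mF; exact: bigcupT_measurable.
Qed.

(** A separate name, to carry the measure structure on Borel sets while [outer_ext] carries that of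
    an outer measure. *)
Definition borel_ext : set BT -> \bar R := outer_ext.

Lemma borel_ext_semi_sigma_additive : semi_sigma_additive borel_ext.
Proof.
move=> F mF tF mUF.
apply: (@caratheodory_measure_sigma_additive R T outer_ext) => //.
  by move=> i; exact: borel_caratheodory.
exact: borel_caratheodory.
Qed.

HB.instance Definition _ := isMeasure.Build _ BT R borel_ext outer_ext0
  outer_ext_ge0 borel_ext_semi_sigma_additive.

Lemma borel_extT : borel_ext setT = 1%E.
Proof. by rewrite /borel_ext /outer_ext outer_contentT. Qed.

HB.instance Definition _ := Measure_isProbability.Build _ BT R borel_ext borel_extT.

Definition borel_probability : probability BT R := borel_ext.

Lemma borel_probabilityE (A : set BT) : borel_probability A = (outer_content A)%:E.
Proof. by []. Qed.

Lemma borel_probability_closed K : closed K -> ((m K)%:E <= borel_probability K)%E.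
Proof. by move=> cK; rewrite lee_fin outer_content_closed. Qed.

Lemma borel_probability_outer_regular (A : set BT) :
  borel_probability A =
  ereal_inf [set borel_probability U | U in [set U : set T | open U /\ A `<=` U]].
Proof.
apply/eqP; rewrite eq_le; apply/andP; split.
  by apply: le_ereal_inf_tmp => _ [U [oU AU] <-]; exact: le_outer_ext.
apply/lee_addgt0Pr => e /(outer_content_adherent A)[U [oU AU UA]].
apply: (@le_trans _ _ (borel_probability U)); first by apply: ereal_inf_lbound; exists U.
by rewrite lee_fin outer_content_open.
Qed.

(** Outer regularity applied to the complement of [A]: the complement of an open set is compact
    here. *)
Lemma borel_probability_inner_regular (A : set BT) : measurable A ->
  borel_probability A =
  ereal_sup [set borel_probability K | K in [set K : set T | compact K /\ K `<=` A]].
Proof.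
have mO (U : set T) : open U -> measurable (U : set BT).
  by move=> oU; exact: sub_sigma_algebra.
move=> mA; apply/eqP; rewrite eq_le; apply/andP; split; last first.
  by apply: ge_ereal_sup => _ [K [_ KA] <-]; exact: le_outer_ext.
apply/lee_addgt0Pr => e /(outer_content_adherent (~` A))[U [oU AU UA]].
pose K := ~` U.
apply: (@le_trans _ _ (borel_probability K + e%:E)%E); last first.
  rewrite leeD2r //; apply: ereal_sup_ubound; exists K => //; split.
    by apply: subclosed_compact cT _ => //; exact: open_closedC.
  by rewrite /K -[X in _ `<=` X]setCK; apply: subsetC.
have PK : borel_probability K = (1 - borel_probability U)%E.
  by rewrite probability_setC //; exact: mO.
have PA : borel_probability (~` A) = (1 - borel_probability A)%E.
  by rewrite probability_setC.
rewrite PK; move: PA UA; rewrite -outer_content_open //.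
rewrite !borel_probabilityE -!EFinB -EFinD => -[->]; rewrite lee_fin; lra.
Qed.

End RegularBorelExtension.

(** * Representing measures on the boundary *)

Section CompactBorel.
Variables (R : realType) (T : ptopologicalType).
Local Notation BT := (g_sigma_algebraType (@open T)).

Lemma closed_borel (K : set T) : closed K -> measurable (K : set BT).
Proof.
move=> cK; rewrite -[K]setCK; apply: measurableC.
by apply: sub_sigma_algebra; exact: closed_openC.
Qed.

Lemma continuous_borel (f : T -> R) (A : set BT) : measurable A ->
  continuous f -> measurable_fun A (f : BT -> R).
Proof.
move=> mA /continuousP cf.
apply: (measurability _ (measurable_realfun.RGenOInfty.measurableE R)).
move=> _ [_ [r ->] <-]; apply: measurableI => //.
apply: sub_sigma_algebra; apply: cf; rewrite set_itv_o_infty; exact: open_gt.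
Qed.

Lemma continuous_integrable (P : probability BT R) (f : T -> R) (A : set BT) :
  compact [set: T] -> measurable A -> continuous f ->
  P.-integrable A (EFin \o (f : BT -> R)).
Proof.
move=> cT mA cf; apply: measurable_bounded_integrable => //.
- by rewrite (le_lt_trans (probability_le1 P mA)) ?ltry.
- exact: continuous_borel.
have : bounded_set (f @` [set: T]).
  apply: compact_bounded; apply: continuous_compact => //.
  exact: continuous_subspaceT.
by move=> [M [Mr hM]]; exists M; split => // N MN x _; apply: (hM N MN); exists x.
Qed.

End CompactBorel.

Section SubspaceCompact.
Variables (T : topologicalType) (A : set T).

Lemma set_val_continuous : continuous (fun x : set_type A => sval x : T).
Proof. exact: initial_continuous. Qed.

(** The image filter in [T] has a cluster point in [A], which lifts to the subtype. *)
Lemma set_type_compact : compact A -> compact [set: set_type A].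
Proof.
move=> cA F FF _.
have [|p [Ap clp]] := cA (fmap (fun x : set_type A => sval x) F).
  suff : F [set x | A (sval x)] by [].
  by apply: (@filterS _ F _ setT) filterT => x _; exact: set_mem (svalP x).
pose x : set_type A := exist _ p (mem_set Ap).
exists x; split => //; move=> B C FB [_ [[W oW <-] Wx] WC].
have FsB : F [set y : set_type A | ((fun x : set_type A => sval x) @` B) (sval y)].
  by apply: (@filterS _ F _ B) FB => y By; exists y.
have [_ [[y By <-] Wy]] := clp _ W FsB (open_nbhs_nbhs (conj oW Wx)).
by exists y; split => //; exact: WC.
Qed.

Lemma set_type_hausdorff : hausdorff_space T -> hausdorff_space (set_type A).
Proof.
move=> hT x y xy; apply: val_inj; apply: hT => B C xB yC.
have [z [Bz Cz]] := xy _ _ (@set_val_continuous x B xB) (@set_val_continuous y C yC).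
by exists (sval z).
Qed.

End SubspaceCompact.

(** * Barycenters and uniqueness of the representing measure *)

Section Representation.
Variables (R : realType) (E : peaType) (h : @state_space R E !=set0).
Hypothesis hB : bauer_simplex (@state_space R E).
Local Notation RE := {ptws pea_car E -> Real.sort R}.
Local Notation S := (@state_space R E).
Local Notation X := (@ext_states R E).
Local Notation T := (state_space_type h).
Local Notation BT := (borel_states h).
Local Notation B := (@ext_boundary R E h).
Local Notation ev := (@ahat R E h).
Implicit Types (P Q : probability BT R) (F G : set T) (s : E -> R) (a : E).

Let cS : compact S. Proof. by case: hB. Qed.
Let latS : lattice_cone (gen_cone S). Proof. by case: hB => _ []. Qed.
Let cT : compact [set: T]. Proof. exact: set_type_compact. Qed.
Let hT : hausdorff_space T.
Proof. exact: set_type_hausdorff (@ptws_hausdorff R E). Qed.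

Let vT (x : T) : RE := sval x.

Lemma state_val_continuous : continuous vT.
Proof. exact: set_val_continuous. Qed.

Lemma ext_boundary_closed : closed (B : set T).
Proof.
have [_ _ cX] := hB; have clX := compact_closed (@ptws_hausdorff R E) cX.
by have /continuous_closedP := state_val_continuous; exact.
Qed.

Lemma ext_boundary_measurable : measurable B.
Proof. exact: (@closed_borel T _ ext_boundary_closed). Qed.

Lemma lin_val_continuous (l : seq (R * E)) : continuous (fun x : T => lin l (vT x)).
Proof.
move=> x; apply: continuous_comp; first exact: state_val_continuous.
exact: lin_continuous.
Qed.

Lemma ahat_continuous a : continuous (ev a : T -> R).
Proof.
move=> x; apply: (@continuous_comp T RE R vT (fun z => z a)).
  exact: state_val_continuous.
exact: coord_continuous.
Qed.

Lemma lin_integrable P (A : set BT) (l : seq (R * E)) : measurable A ->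
  P.-integrable A (EFin \o (fun x : BT => lin l (vT x))).
Proof.
move=> mA; apply: (@continuous_integrable R T) => //.
exact: lin_val_continuous.
Qed.

Lemma ahat_integrable P (A : set BT) a : measurable A ->
  P.-integrable A (EFin \o ev a).
Proof.
move=> mA; apply: (@continuous_integrable R T) => //.
exact: ahat_continuous.
Qed.

Lemma ahat_itv a (x : BT) : 0 <= ev a x <= 1.
Proof.
have [mx x1] : S (sval x) by exact: set_mem (svalP x).
by rewrite -x1; exact: (measure_itv a mx).
Qed.

(** Not normalized: its total mass is [P A], so that barycenters over disjoint sets add up. *)
Definition barycenter P (A : set BT) : RE := fun a => Rintegral P A (ev a).

Lemma barycenter_measure P (A : set BT) : measurable A -> is_measure (barycenter P A).
Proof.
move=> mA; split => [a b c abc|a]; last first.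
  by apply: Rintegral_ge0 => x _; case/andP: (ahat_itv a x).
rewrite /barycenter -RintegralD //; [|exact: ahat_integrable..].
apply: eq_Rintegral => x _; have [[xD _] _] : S (sval x) by exact: set_mem (svalP x).
exact: xD.
Qed.

Lemma barycenter_one P (A : set BT) : measurable A ->
  barycenter P A (pea_one E) = fine (P A).
Proof.
move=> mA; rewrite -[RHS]mul1r -Rintegral_cst //.
apply: eq_Rintegral => x _; have [_ x1] : S (sval x) by exact: set_mem (svalP x).
exact: x1.
Qed.

Lemma lin_barycenter P (A : set BT) (l : seq (R * E)) : measurable A ->
  lin l (barycenter P A) = Rintegral P A (fun x => lin l (vT x)).
Proof.
move=> mA; elim: l => [|[c a] l IH].
  rewrite lin_nil (@eq_Rintegral _ _ _ P A (fun=> 0)) => [|x _]; last by rewrite lin_nil.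
  by rewrite Rintegral_cst // mul0r.
rewrite lin_cons IH /barycenter -RintegralZl //; last exact: ahat_integrable.
rewrite -RintegralD //; last 2 first.
- have := @lin_integrable P A [:: (c, a)] mA; congr (P.-integrable A _).
  by apply/funext => x; rewrite /= lin_cons lin_nil addr0.
- exact: lin_integrable.
by apply: eq_Rintegral => x _; rewrite lin_cons.
Qed.

Lemma barycenter_bipolar P (A : set BT) : measurable A ->
  bipolar (vT @` A) (barycenter P A).
Proof.
move=> mA l lA; rewrite lin_barycenter //.
by apply: Rintegral_ge0 => x Ax; apply: lA; exists x.
Qed.

(** The difference is the barycenter over the rest of the boundary, hence a measure. *)
Lemma barycenter_le P s (A : set BT) : boundary_representing s P ->
  measurable A -> A `<=` B -> jle (barycenter P A) s.
Proof.
move=> [_ _ sE] mA AB; have mB := ext_boundary_measurable.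
have mBA : measurable (B `\` A) by exact: measurableD.
apply: (jleE (barycenter_measure P mBA)) => a.
rewrite sE -{2}(setUIDK B A) (setIidr AB) Rintegral_setU //.
- by rewrite /barycenter [X in X - _]addrC addrK.
- by apply: ahat_integrable; exact: measurableU.
by apply/disj_setPS => x [Ax [_]].
Qed.

Lemma boundary_concentrated P (A : set BT) : P B = 1%E -> measurable A ->
  P A = P (A `&` B).
Proof.
move=> PB mA; have mB := ext_boundary_measurable.
rewrite (measureDI _ mA mB) [X in (X + _)%E](_ : _ = 0%E) ?add0e //.
apply/eqP; rewrite eq_le measure_ge0 andbT.
apply: (@le_trans _ _ (P (~` B))).
  by apply: le_measure; rewrite ?inE; [exact: measurableD|exact: measurableC|move=> x []].
by rewrite probability_setC // PB subee.
Qed.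

(** By [bipolar_disjoint] the barycenters over [F] and [G] have a sum below [s]; evaluating at the
    unit element gives the inequality. *)
Lemma representing_disjoint P Q s (F G : set T) : is_measure s ->
  boundary_representing s P -> boundary_representing s Q ->
  s (pea_one E) = 1 -> closed F -> closed G -> F `<=` B -> G `<=` B ->
  F `&` G = set0 -> (P F + Q G <= 1)%E.
Proof.
move=> ms sP sQ s1 cF cG FB GB FG.
have mF : measurable (F : set BT) by exact: (@closed_borel T).
have mG : measurable (G : set BT) by exact: (@closed_borel T).
have cl (K : set T) : closed K -> closed (vT @` K).
  move=> cK; apply: (compact_closed (@ptws_hausdorff R E)).
  apply: continuous_compact; first exact/continuous_subspaceT/state_val_continuous.
  exact: subclosed_compact cK cT _.
have eX (K : set T) : K `<=` B -> vT @` K `<=` X.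
  by move=> KB _ [x Kx <-]; exact: KB.
have disj : (vT @` F) `&` (vT @` G) = set0.
  apply/seteqP; split => // _ [[x Fx <-] [y Gy /val_inj yx]].
  by have : (F `&` G) x; [split; rewrite // -yx|rewrite FG].
have := bipolar_disjoint h cS latS (cl _ cF) (cl _ cG) (eX _ FB) (eX _ GB) disj
  (barycenter_measure P mF) (barycenter_measure Q mG)
  (barycenter_bipolar P mF) (barycenter_bipolar Q mG) ms
  (barycenter_le sP mF FB) (barycenter_le sQ mG GB).
move=> /(is_measure_ge0 (pea_one E)).
rewrite !barycenter_one // s1 subr_ge0 => PQ.
by rewrite -[P F]fineK ?fin_num_measure // -[Q G]fineK ?fin_num_measure // -EFinD lee_fin.
Qed.

Lemma representing_le P Q s (A : set BT) : is_state s ->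
  boundary_representing s P -> boundary_representing s Q -> measurable A ->
  (P A <= Q A)%E.
Proof.
move=> [ms s1] sP sQ mA; have [rP PB _] := sP; have [rQ QB _] := sQ.
have cB := ext_boundary_closed.
have cK (K : set T) : compact K -> closed (K `&` B).
  by move=> kK; apply: closedI => //; exact: compact_closed hT kK.
have mK (K : set T) : compact K -> measurable (K : set BT).
  by move=> kK; apply: (@closed_borel T); exact: compact_closed hT kK.
rewrite (rP A mA).1; apply: ge_ereal_sup => _ [K [kK KA] <-].
(* Compact sets [K] in [A] and [L] in its complement are disjoint, and both measures see only their
   closed traces on the boundary. Inner regularity of [Q] takes the supremum over [L]. *)
have : (Q (~` A) <= 1 - P K)%E.
  rewrite (rQ _ (measurableC mA)).1; apply: ge_ereal_sup => _ [L [kL LA] <-].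
  rewrite leeBrDr ?fin_num_measure //; last exact: mK.
  rewrite (boundary_concentrated PB (mK _ kK)) (boundary_concentrated QB (mK _ kL)).
  rewrite addeC; apply: (representing_disjoint ms sP sQ s1 (cK _ kK) (cK _ kL)).
  - by move=> x [].
  - by move=> x [].
  by apply/seteqP; split => // x [[/KA Ax _] [/LA]].
rewrite probability_setC //.
rewrite -[P K]fineK ?fin_num_measure //; last exact: mK.
rewrite -[Q A]fineK ?fin_num_measure // -!EFinB !lee_fin; lra.
Qed.

Lemma representing_unique P Q s (A : set BT) : is_state s ->
  boundary_representing s P -> boundary_representing s Q -> measurable A ->
  P A = Q A.
Proof.
move=> Ss sP sQ mA; apply/eqP; rewrite eq_le.
by rewrite (representing_le Ss sP sQ) // (representing_le Ss sQ sP).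
Qed.

(** * Existence of the representing measure *)

Section Existence.
Variables (s : RE) (m : set RE -> R).
Hypotheses (Ss : S s) (mP : finitely_additive_probability m) (mX : m X = 1).
Hypothesis ms : forall a n, n%:R * s a <= \sum_(k < n) m (layer a n k) + 1.

Let m' (A : set T) : R := m (vT @` A).

Let vT_inj : injective vT. Proof. exact: val_inj. Qed.

Let m_setIX (A : set RE) : m A = m (A `&` X).
Proof.
have mCX : m (~` X) = 0.
  have := faprobT mP; rewrite -(setUv X) (faprobU mP) ?setICr // mX; lra.
rewrite -{1}(setUIDK A X) (faprobU mP); last first.
  by apply/seteqP; split => // x [[_ ?] [_]].
rewrite [X in _ + X](_ : _ = 0) ?addr0 1?setIC //; apply/eqP.
rewrite eq_le (faprob_ge0 mP) andbT -mCX; apply: (faprob_le mP).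
by move=> x [].
Qed.

Let m'P : finitely_additive_probability m'.
Proof.
split => [A|A C AC|]; first exact: (faprob_ge0 mP).
  rewrite /m' image_setU (faprobU mP) //; apply/seteqP; split => //.
  move=> _ [[x Ax <-] [y Cy /vT_inj yx]].
  by have : (A `&` C) x; [split; rewrite // -yx|rewrite AC].
apply/eqP; rewrite eq_le (faprob_le1 mP) -mX; apply: (faprob_le mP).
move=> x Xx; have Sx : S x by case: Xx.
by exists (exist _ x (mem_set Sx)).
Qed.

Let P : probability BT R := borel_probability hT cT m'P.

Lemma extension_regular : regular_measure P.
Proof.
move=> A mA; split; first exact: borel_probability_inner_regular.
exact: borel_probability_outer_regular.
Qed.

Lemma extension_boundary : P B = 1%E.
Proof.
have mB := ext_boundary_measurable.
apply/eqP; rewrite eq_le probability_le1 //=.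
have := borel_probability_closed hT cT m'P ext_boundary_closed.
apply: le_trans; rewrite lee_fin -mX; apply: (faprob_le mP) => x Xx.
have Sx : S x by case: Xx.
by exists (exist _ x (mem_set Sx)).
Qed.

(** The traces of the layers on the boundary are closed, so [P] dominates [m] on them. Their
    indicators sum to at most [n%:R * ev a x], which is then integrated. *)
Lemma extension_layer a n :
  \sum_(k < n) m (layer a n k) <= n%:R * barycenter P B a.
Proof.
have mB := ext_boundary_measurable.
pose L (k : 'I_n) : set T := B `&` [set x | k.+1%:R <= n%:R * ev a x].
have cL k : closed (L k).
  apply: closedI; first exact: ext_boundary_closed.
  have /continuous_closedP : continuous (fun x : T => n%:R * ev a x).
    apply: continuous_mul; first exact: cst_continuous.
    exact: ahat_continuous.
  by move=> /(_ _ (@closed_ge R k.+1%:R)).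
have mL k : measurable (L k : set BT) by exact: (@closed_borel T).
have h1 (k : 'I_n) : m (layer a n k) <= fine (P (L k)).
  rewrite -lee_fin fineK ?fin_num_measure //.
  apply: le_trans (borel_probability_closed hT cT m'P (cL k)).
  rewrite lee_fin m_setIX; apply: (faprob_le mP) => x [Lx Xx].
  have Sx : S x by case: Xx.
  by exists (exist _ x (mem_set Sx)).
apply: (le_trans (ler_sum _ (fun k _ => h1 k))).
have iev : P.-integrable B (EFin \o (fun x => n%:R * ev a x)).
  have := @lin_integrable P B [:: (n%:R, a)] mB; congr (P.-integrable B _).
  by apply/funext => x; rewrite /= lin_cons lin_nil addr0.
have iL (k : 'I_n) : P.-integrable B (fun x => (\1_(L k : set BT) x)%:E).
  apply: (integrableS measurableT mB (@subsetT _ _)).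
  exact: integrable_indic.
rewrite /barycenter -RintegralZl //; last exact: ahat_integrable.
rewrite -lee_fin /Rintegral fineK; last exact: integrable_fin_num.
rewrite -sumEFin (eq_bigr (fun k => \int[P]_(x in B) (\1_(L k : set BT) x)%:E)%E).
  rewrite -integral_sum //; apply: le_integral => //.
    exact: integrable_sum.
  move=> x; rewrite inE => Bx; rewrite sumEFin lee_fin.
  rewrite [leLHS](_ : _ = \sum_(k < n) (k.+1%:R <= n%:R * ev a x)%R%:R).
    by apply: layer_sum_le; rewrite mulr_ge0 //; case/andP: (ahat_itv a x).
  apply: eq_bigr => k _; rewrite indicE; case: lerP => kx.
    by rewrite mem_set //; split.
  by rewrite memNset // => -[_] /=; rewrite leNgt kx.
move=> k _; rewrite integral_indic // setIidl ?fineK ?fin_num_measure //.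
by move=> x [].
Qed.

Lemma extension_representing : boundary_representing s P.
Proof.
have mB := ext_boundary_measurable.
have P1 : barycenter P B (pea_one E) = 1.
  by rewrite barycenter_one // extension_boundary.
split; [exact: extension_regular|exact: extension_boundary|].
have sle a : s a <= barycenter P B a.
  rewrite leNgt; apply/negP; rewrite -subr_gt0; set d := _ - _ => d0.
  (* The layer estimates have total error 1, which a gap of [n%:R * d > 1] contradicts. *)
  have [n nd] : exists n : nat, 1 < n%:R * d.
    exists (Num.truncn d^-1).+1.
    by rewrite -ltr_pdivrMr // div1r truncnS_gt.
  have := ms a n; have := extension_layer a n.
  have : n%:R * d = n%:R * s a - n%:R * barycenter P B a by rewrite /d; ring.
  lra.
(* For the reverse inequality, apply [sle] to the complement [d] of [a]: both sides have total mass
   1 on [a + d]. *)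
move=> a; apply/eqP; rewrite eq_le sle /=.
have [[d [ad _]] _] := pea_compl a.
have [[sD _] s1] := Ss; have [bD _] := barycenter_measure P mB.
have := sle d; have := sD _ _ _ ad; have := bD _ _ _ ad; rewrite P1 s1.
rewrite -/(barycenter P B a); lra.
Qed.

End Existence.

Lemma representing_exists s : is_state s -> exists P, boundary_representing s P.
Proof.
move=> Ss; have [m [mP mX ms]] := faprob_representation (s := s) cS Ss.
by eexists; exact: (extension_representing Ss mP mX ms).
Qed.

End Representation.

Theorem theorem5p8 (R : realType) (E : peaType)
    (hne : @state_space R E !=set0)
    (hB : bauer_simplex (@state_space R E))
    (m : E -> R) (hm : jordan_signed_measure m)
    (a1 a2 : R) (s1 s2 : E -> R)
    (hdec : canonical_jordan_decomposition m a1 s1 a2 s2) :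
  exists mu1 mu2 : probability (borel_states hne) R,
    [/\ boundary_representing s1 mu1 /\
          (forall nu : probability (borel_states hne) R,
             boundary_representing s1 nu ->
             forall A : set (borel_states hne), measurable A -> nu A = mu1 A),
        boundary_representing s2 mu2 /\
          (forall nu : probability (borel_states hne) R,
             boundary_representing s2 nu ->
             forall A : set (borel_states hne), measurable A -> nu A = mu2 A) &
        forall a : E,
          m a = a1 * Rintegral mu1 (@ext_boundary R E hne) (@ahat R E hne a)
                - a2 * Rintegral mu2 (@ext_boundary R E hne) (@ahat R E hne a) /\
          m a = signed_Rintegral a1 mu1 a2 mu2 (@ext_boundary R E hne) (@ahat R E hne a)].
Proof.
have [_ [Ss1 Ss2] mE _ _] := hdec.
have [mu1 rep1] := representing_exists hne hB Ss1.
have [mu2 rep2] := representing_exists hne hB Ss2.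
exists mu1, mu2; split.
- by split => // nu rep A mA; exact: (representing_unique hB Ss1 rep rep1 mA).
- by split => // nu rep A mA; exact: (representing_unique hB Ss2 rep rep2 mA).
have [_ _ i1] := rep1; have [_ _ i2] := rep2.
by move=> a; rewrite /signed_Rintegral -i1 -i2 mE.
Qed.
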